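(* Let $E$ be a connected Hopf algebra over a field $K$ with $\mathrm{char}(K)=0$. Assume that $E\neq K$. Then, for every $x\in P(E)\setminus\{0\}$, there exists a weak projection $\pi:E\to K[x]$. In particular there is a $K$-linear isomorphism $$E\simeq K[x]\otimes\frac{E}{xE}.$$
   Context: Connected means that the coradical of $E$ is $K1_E$. $P(E)=\{x\in E\mid\Delta(x)=x\otimes1+1\otimes x\}$ is the space of primitive elements. $K[x]$ denotes the subalgebra of $E$ generated by $x$, which is a Hopf subalgebra. A weak projection of a bialgebra $E$ onto a Hopf subalgebra $H$ is a retraction $\pi:E\to H$ of the inclusion map ($\pi|_H=\mathrm{Id}_H$) which is a left $H$-linear coalgebra map. *)

(* Defs.v *)
From HB Require Import structures.
From mathcomp Require Import all_boot all_algebra boolp.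

Set Implicit Arguments.
Unset Strict Implicit.
Unset Printing Implicit Defensive.

Import GRing.Theory.
Local Open Scope ring_scope.
Local Open Scope quotient_scope.

(* A list [:: (v1, w1); ..; (vn, wn)] stands for v1 ⊗ w1 + .. + vn ⊗ wn, and
   tensor_eq is the congruence of the free commutative monoid on V * W generated
   by the defining relations of the tensor product over R. *)
Inductive tensor_eq (R : comNzRingType) (V W : lmodType R) :
    seq (V * W) -> seq (V * W) -> Prop :=
| TensorRefl s : tensor_eq s s
| TensorSym s t : tensor_eq s t -> tensor_eq t s
| TensorTrans s t u : tensor_eq s t -> tensor_eq t u -> tensor_eq s u
| TensorCat s s' t t' :
    tensor_eq s s' -> tensor_eq t t' -> tensor_eq (s ++ t) (s' ++ t')
| TensorComm s t : tensor_eq (s ++ t) (t ++ s)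
| Tensor0 w : tensor_eq [:: (0, w)] [::]
| TensorDl v v' w : tensor_eq [:: (v + v', w)] [:: (v, w); (v', w)]
| TensorDr v w w' : tensor_eq [:: (v, w + w')] [:: (v, w); (v, w')]
| TensorZ a v w : tensor_eq [:: (a *: v, w)] [:: (v, a *: w)].

Section TensorProduct.
Variables (R : comNzRingType) (V W : lmodType R).
Implicit Types (s t : seq (V * W)) (v : V) (w : W) (a : R).

Definition tensor_rel : rel (seq (V * W)) := fun s t => `[< tensor_eq s t >].

Lemma tensor_relP s t : reflect (tensor_eq s t) (tensor_rel s t).
Proof. exact: asboolP. Qed.

Lemma tensor_rel_refl : reflexive tensor_rel.
Proof. by move=> s; apply/tensor_relP; constructor. Qed.
Lemma tensor_rel_sym : symmetric tensor_rel.
Proof.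
by move=> s t; apply/tensor_relP/tensor_relP => h; apply: TensorSym.
Qed.
Lemma tensor_rel_trans : transitive tensor_rel.
Proof.
by move=> t s u /tensor_relP st /tensor_relP tu; apply/tensor_relP/(TensorTrans st).
Qed.

Canonical tensor_equiv :=
  EquivRel tensor_rel tensor_rel_refl tensor_rel_sym tensor_rel_trans.

Definition tensor := {eq_quot tensor_equiv}.
HB.instance Definition _ := Choice.on tensor.
HB.instance Definition _ := EqQuotient.on tensor.

Definition tens v w : tensor := \pi_tensor [:: (v, w)].

Lemma tensor_piP s t : reflect (\pi_tensor s = \pi_tensor t) (tensor_rel s t).
Proof. by apply: (iffP idP) => [h|/eqmodP //]; apply/eqmodP. Qed.

Lemma tensor_eqP s t : \pi_tensor s = \pi_tensor t <-> tensor_eq s t.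
Proof. by split=> [/tensor_piP/tensor_relP //|h]; apply/tensor_piP/tensor_relP. Qed.

Let negs s := [seq (- p.1, p.2) | p <- s].
Let scales a s := [seq (a *: p.1, p.2) | p <- s].

Let tensor_eq_scale a s t :
  tensor_eq s t -> tensor_eq (scales a s) (scales a t).
Proof.
elim=> {s t} /=.
- by move=> s; constructor.
- by move=> s t _; apply: TensorSym.
- by move=> s t u _ h _; apply: TensorTrans.
- by move=> s s' t t' _ h _ h'; rewrite /scales !map_cat; apply: TensorCat.
- by move=> s t; rewrite /scales !map_cat; apply: TensorComm.
- by move=> w; rewrite scaler0; apply: Tensor0.
- by move=> v v' w; rewrite scalerDr; apply: TensorDl.
- by move=> v w w'; apply: TensorDr.
- by move=> b v w; rewrite scalerA mulrC -scalerA; apply: TensorZ.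
Qed.

Let tensor_eq_neg s t : tensor_eq s t -> tensor_eq (negs s) (negs t).
Proof.
have E u : negs u = scales (-1) u by apply: eq_map => p; rewrite scaleN1r.
by rewrite !E; apply: tensor_eq_scale.
Qed.

Definition tensor0 : tensor := \pi_tensor [::].
Definition tensorD (x y : tensor) : tensor := \pi_tensor (repr x ++ repr y).
Definition tensorN (x : tensor) : tensor :=
  \pi_tensor [seq (- p.1, p.2) | p <- repr x].
Definition tensorZ a (x : tensor) : tensor :=
  \pi_tensor [seq (a *: p.1, p.2) | p <- repr x].

Let repr_pi s : tensor_eq (repr (\pi_tensor s)) s.
Proof. by apply/tensor_eqP; rewrite reprK. Qed.

Let piD s t : tensorD (\pi_tensor s) (\pi_tensor t) = \pi_tensor (s ++ t).
Proof. by apply/tensor_eqP; apply: TensorCat; apply: repr_pi. Qed.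
Let piN s : tensorN (\pi_tensor s) = \pi_tensor (negs s).
Proof. by apply/tensor_eqP; apply/tensor_eq_neg/repr_pi. Qed.
Let piZ a s : tensorZ a (\pi_tensor s) = \pi_tensor (scales a s).
Proof. by apply/tensor_eqP; apply/tensor_eq_scale/repr_pi. Qed.

Let addA : associative tensorD.
Proof.
by elim/quotW=> s; elim/quotW=> t; elim/quotW=> u; rewrite (piD t u) (piD s t) (piD s) piD catA.
Qed.
Let addC : commutative tensorD.
Proof.
by elim/quotW=> s; elim/quotW=> t; rewrite !piD; apply/tensor_eqP/TensorComm.
Qed.
Let add0 : left_id tensor0 tensorD.
Proof. by elim/quotW=> s; rewrite /tensor0 piD. Qed.

HB.instance Definition _ := GRing.isNmodule.Build tensor addA addC add0.

Lemma tensor_piD s t : \pi_tensor s + \pi_tensor t = \pi_tensor (s ++ t).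
Proof. exact: piD. Qed.

Lemma tensor_piE s : \pi_tensor s = \sum_(p <- s) tens p.1 p.2.
Proof.
elim: s => [|[v w] s IHs]; first by rewrite big_nil.
by rewrite big_cons -IHs -cat1s -tensor_piD.
Qed.

Lemma tensorE (x : tensor) : x = \sum_(p <- repr x) tens p.1 p.2.
Proof. by rewrite -tensor_piE reprK. Qed.

Let tens0l w : tens 0 w = 0.
Proof. exact/tensor_eqP/Tensor0. Qed.

Lemma tensDl v v' w : tens (v + v') w = tens v w + tens v' w.
Proof. by rewrite /tens tensor_piD; apply/tensor_eqP/TensorDl. Qed.

Lemma tensDr v w w' : tens v (w + w') = tens v w + tens v w'.
Proof. by rewrite /tens tensor_piD; apply/tensor_eqP/TensorDr. Qed.

Let addN : left_inverse 0 tensorN +%R.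
Proof.
elim/quotW=> s; rewrite piN !tensor_piE big_map -big_split big1 //= => p _.
by rewrite -tensDl addNr tens0l.
Qed.

HB.instance Definition _ := GRing.Nmodule_isZmodule.Build tensor addN.

Let scaleA a b x : tensorZ a (tensorZ b x) = tensorZ (a * b) x.
Proof.
elim/quotW: x => s; rewrite (piZ b) (piZ a) (piZ (a * b)); congr (\pi_tensor _).
by rewrite /scales -map_comp; apply: eq_map => p /=; rewrite scalerA.
Qed.
Let scale1 : left_id 1 tensorZ.
Proof.
elim/quotW=> s; rewrite piZ; congr (\pi_tensor _).
by rewrite -[RHS]map_id; apply: eq_map => -[v w] /=; rewrite scale1r.
Qed.
Let scaleDr : right_distributive tensorZ +%R.
Proof.
move=> a; elim/quotW=> s; elim/quotW=> t.
rewrite tensor_piD (piZ a (s ++ t)) (piZ a s) (piZ a t) tensor_piD.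
by rewrite /scales map_cat.
Qed.
Let scaleDl x : {morph tensorZ^~ x : a b / a + b}.
Proof.
elim/quotW: x => s a b; rewrite (piZ (a + b)) (piZ a) (piZ b) !tensor_piE !big_map -big_split /=.
by apply: eq_bigr => p _; rewrite scalerDl tensDl.
Qed.

HB.instance Definition _ :=
  GRing.Zmodule_isLmodule.Build R tensor scaleA scale1 scaleDr scaleDl.

Lemma tensZl a v w : tens (a *: v) w = a *: tens v w.
Proof. by rewrite /tens [RHS]piZ. Qed.

Lemma tensZr a v w : tens v (a *: w) = a *: tens v w.
Proof. by rewrite -tensZl; apply/tensor_eqP/TensorSym/TensorZ. Qed.

Lemma tens_bilinear : bilinear_for *:%R *:%R tens.
Proof.
by split=> [w|v] a x y; rewrite (tensDl, tensDr) (tensZl, tensZr).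
Qed.

HB.instance Definition _ :=
  bilinear_isBilinear.Build R V W tensor *:%R *:%R tens tens_bilinear.

End TensorProduct.

Arguments tensor {R} (V W)%_type_scope.
Notation "V ⊗ W" := (tensor V W) (at level 40, left associativity) : type_scope.
Notation "v ⊗ w" := (tens v w) (at level 40, left associativity) : ring_scope.

Section TensorLift.
Variables (R : comNzRingType) (V W U : lmodType R).

(* Only meaningful for bilinear b, in which case it is the linear map with
   v ⊗ w |-> b v w; otherwise it depends on the choice of representatives. *)
Definition tlift (b : V -> W -> U) (x : V ⊗ W) : U :=
  \sum_(p <- repr x) b p.1 p.2.

Lemma tlift_fun_linear (b b' : V -> W -> U) a x :
  tlift (fun v w => a *: b v w + b' v w) x = a *: tlift b x + tlift b' x.
Proof. by rewrite /tlift scaler_sumr -big_split. Qed.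

Variable b : V -> W -> U.
Hypothesis b_bilin : bilinear_for *:%R *:%R b.

Let bD1 v v' w : b (v + v') w = b v w + b v' w.
Proof. by have := b_bilin.1 w 1 v v'; rewrite /= !scale1r. Qed.
Let bD2 v w w' : b v (w + w') = b v w + b v w'.
Proof. by have := b_bilin.2 v 1 w w'; rewrite /= !scale1r. Qed.
Let b01 w : b 0 w = 0.
Proof. by apply: (addrI (b 0 w)); rewrite -bD1 !addr0. Qed.
Let b02 v : b v 0 = 0.
Proof. by apply: (addrI (b v 0)); rewrite -bD2 !addr0. Qed.
Let bZ1 a v w : b (a *: v) w = a *: b v w.
Proof. by have := b_bilin.1 w a v 0; rewrite /= b01 !addr0. Qed.
Let bZ2 a v w : b v (a *: w) = a *: b v w.
Proof. by have := b_bilin.2 v a w 0; rewrite /= b02 !addr0. Qed.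

Let sum_tensor_eq s t : tensor_eq s t ->
  \sum_(p <- s) b p.1 p.2 = \sum_(p <- t) b p.1 p.2.
Proof.
elim=> {s t} //=.
- by move=> s t u _ -> _ ->.
- by move=> s s' t t' _ h _ h'; rewrite !big_cat h h'.
- by move=> s t; rewrite !big_cat /= addrC.
- by move=> w; rewrite big_seq1 big_nil.
- by move=> v v' w; rewrite big_seq1 big_cons big_seq1 /= bD1.
- by move=> v w w'; rewrite big_seq1 big_cons big_seq1 /= bD2.
- by move=> a v w; rewrite !big_seq1 /= bZ1 bZ2.
Qed.

Let tlift_pi s : tlift b (\pi_(V ⊗ W) s) = \sum_(p <- s) b p.1 p.2.
Proof. by apply/sum_tensor_eq/tensor_eqP; rewrite reprK. Qed.

Lemma tliftE v w : tlift b (v ⊗ w) = b v w.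
Proof. by rewrite tlift_pi big_seq1. Qed.

Lemma tlift_linear : linear (tlift b).
Proof.
have D x y : tlift b (x + y) = tlift b x + tlift b y.
  by rewrite -[x]reprK -[y]reprK tensor_piD !tlift_pi big_cat.
move=> a x y; rewrite D; congr (_ + _).
rewrite {1}[x]tensorE scaler_sumr.
under eq_bigr do rewrite -tensZl.
have -> : \sum_(p <- repr x) (a *: p.1) ⊗ p.2
  = \pi_(V ⊗ W) [seq (a *: p.1, p.2) | p <- repr x].
  by rewrite tensor_piE big_map.
rewrite tlift_pi big_map /tlift scaler_sumr.
by apply: eq_bigr => p _; rewrite /= bZ1.
Qed.

End TensorLift.

(* A linear map out of V ⊗ W is determined by its values on pure tensors. *)
Lemma tensor_ext (R : comNzRingType) (V W U : lmodType R) (f g : V ⊗ W -> U) :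
  linear f -> linear g -> (forall v w, f (v ⊗ w) = g (v ⊗ w)) -> f =1 g.
Proof.
move=> lf lg fg x.
have H (h : V ⊗ W -> U) : linear h -> h x = \sum_(p <- repr x) h (p.1 ⊗ p.2).
  move=> lh.
  pose h' : {linear _ -> _} := HB.pack h (GRing.isLinear.Build _ _ _ _ h lh).
  by rewrite {1}(tensorE x) -[h]/(h' : _ -> _) linear_sum.
by rewrite (H f) // (H g) //; apply: eq_bigr.
Qed.

Section TensorMaps.
Variable R : comNzRingType.
Implicit Types V W U : lmodType R.

Definition tmap V V' W W' (f : V -> V') (g : W -> W') : V ⊗ W -> V' ⊗ W' :=
  tlift (fun v w => f v ⊗ g w).

Lemma tmap_bilinear V V' W W' (f : {linear V -> V'}) (g : {linear W -> W'}) :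
  bilinear_for *:%R *:%R (fun v w => f v ⊗ g w).
Proof. by split=> [w|v] a x y /=; rewrite linearP (linearPl, linearPr). Qed.

Lemma tmapE V V' W W' (f : {linear V -> V'}) (g : {linear W -> W'}) v w :
  tmap f g (v ⊗ w) = f v ⊗ g w.
Proof. by rewrite /tmap (tliftE (tmap_bilinear f g)). Qed.

Lemma tmap_linear V V' W W' (f : {linear V -> V'}) (g : {linear W -> W'}) :
  linear (tmap f g).
Proof. exact: (tlift_linear (tmap_bilinear f g)). Qed.

Definition tassoc V W U : (V ⊗ W) ⊗ U -> V ⊗ (W ⊗ U) :=
  tlift (fun x u => tlift (fun v w => v ⊗ (w ⊗ u)) x).

Lemma tassoc_bilinear_in V W U (u : U) :
  bilinear_for *:%R *:%R (fun (v : V) (w : W) => v ⊗ (w ⊗ u)).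
Proof.
by split=> [w|v] a x y /=; rewrite ?linearPl ?linearPr.
Qed.

Lemma tassoc_bilinear V W U : bilinear_for *:%R *:%R
  (fun (x : V ⊗ W) (u : U) => tlift (fun v w => v ⊗ (w ⊗ u)) x).
Proof.
split=> [u|x] a y z /=; first exact: (tlift_linear (@tassoc_bilinear_in V W U u)).
rewrite -tlift_fun_linear; congr tlift.
by apply/funext => v; apply/funext => w; rewrite !linearPr.
Qed.

Lemma tassocE V W U (v : V) (w : W) (u : U) :
  tassoc ((v ⊗ w) ⊗ u) = v ⊗ (w ⊗ u).
Proof.
by rewrite /tassoc (tliftE (tassoc_bilinear _ _ _))
  (tliftE (@tassoc_bilinear_in V W U u)).
Qed.

Lemma tassoc_linear V W U : linear (@tassoc V W U).
Proof. exact: (tlift_linear (tassoc_bilinear _ _ _)). Qed.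

End TensorMaps.
Arguments tassoc {R V W U} _.

Section TensorAlgebra.
Variables (R : comNzRingType) (A B : algType R).

Definition tmul (x y : A ⊗ B) : A ⊗ B :=
  tlift (fun a b => tlift (fun a' b' => (a * a') ⊗ (b * b')) y) x.

Let bilin_in (a : A) (b : B) :
  bilinear_for *:%R *:%R (fun a' b' => (a * a') ⊗ (b * b')).
Proof.
by split=> [w|v] k x y /=; rewrite mulrDr -scalerAr (linearPl, linearPr).
Qed.

Let bilin_out (y : A ⊗ B) : bilinear_for *:%R *:%R
  (fun a b => tlift (fun a' b' => (a * a') ⊗ (b * b')) y).
Proof.
split=> [w|v] k x z /=; rewrite -tlift_fun_linear; congr tlift;
by apply/funext => a; apply/funext => b;
   rewrite mulrDl -scalerAl (linearPl, linearPr).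
Qed.

Lemma tmulE (a a' : A) (b b' : B) :
  tmul (a ⊗ b) (a' ⊗ b') = (a * a') ⊗ (b * b').
Proof. by rewrite /tmul (tliftE (bilin_out _)) (tliftE (bilin_in _ _)). Qed.

Let tmul_linearl y : linear (tmul^~ y).
Proof. exact: (tlift_linear (bilin_out y)). Qed.
Let tmul_linearr x : linear (tmul x).
Proof.
move=> k y z; rewrite /tmul -tlift_fun_linear; congr tlift.
by apply/funext => a; apply/funext => b; rewrite (tlift_linear (bilin_in a b)).
Qed.

Lemma tmul_bilinear : bilinear_for *:%R *:%R tmul.
Proof. by split=> ?; [apply: tmul_linearl | apply: tmul_linearr]. Qed.

Let mulDl : left_distributive tmul +%R.
Proof. by move=> x y z; have := tmul_linearl z 1 x y; rewrite !scale1r. Qed.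
Let mulDr : right_distributive tmul +%R.
Proof. by move=> x y z; have := tmul_linearr x 1 y z; rewrite !scale1r. Qed.

Let mul1 : left_id (1 ⊗ 1) tmul.
Proof.
apply: tensor_ext => [||a b]; [exact: tmul_linearr|by []|].
by rewrite tmulE !mul1r.
Qed.
Let mulr1 : right_id (1 ⊗ 1) tmul.
Proof.
apply: (tensor_ext (f := tmul^~ (1 ⊗ 1))) => [||a b]; [exact: tmul_linearl|by []|].
by rewrite tmulE !mulr1.
Qed.

Let lin_comp (f g : A ⊗ B -> A ⊗ B) : linear f -> linear g -> linear (f \o g).
Proof. by move=> lf lg k x y /=; rewrite lg lf. Qed.

Let mulA : associative tmul.
Proof.
move=> x y z; apply: (tensor_ext (f := fun x => tmul x (tmul y z))
  (g := fun x => tmul (tmul x y) z)) x => [||a b].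
- exact: tmul_linearl.
- exact: (lin_comp (tmul_linearl z) (tmul_linearl y)).
apply: (tensor_ext (f := fun y => tmul (a ⊗ b) (tmul y z))
  (g := fun y => tmul (tmul (a ⊗ b) y) z)) y => [||a' b'].
- exact: (lin_comp (tmul_linearr _) (tmul_linearl z)).
- exact: (lin_comp (tmul_linearl z) (tmul_linearr _)).
apply: (tensor_ext (f := fun z => tmul (a ⊗ b) (tmul (a' ⊗ b') z))
  (g := fun z => tmul (tmul (a ⊗ b) (a' ⊗ b')) z)) z => [||a'' b''].
- exact: (lin_comp (tmul_linearr _) (tmul_linearr _)).
- exact: tmul_linearr.
by rewrite !tmulE !mulrA.
Qed.

HB.instance Definition _ :=
  GRing.Zmodule_isPzRing.Build (A ⊗ B)%type mulA mul1 mulr1 mulDl mulDr.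

Lemma tensM (a a' : A) (b b' : B) :
  (a ⊗ b) * (a' ⊗ b') = (a * a') ⊗ (b * b').
Proof. exact: tmulE. Qed.

End TensorAlgebra.

Section QuotientSpace.
Variables (R : nzRingType) (V : lmodType R) (S : submodClosed V).

Definition quot_rel : rel V := fun x y => x - y \in S.

Let rpredNS v : (- v \in S) = (v \in S).
Proof.
have H u : u \in S -> - u \in S by move=> uS; rewrite -scaleN1r rpredZ.
by apply/idP/idP => [/H|/H //]; rewrite opprK.
Qed.

Lemma quot_rel_refl : reflexive quot_rel.
Proof. by move=> x; rewrite /quot_rel subrr rpred0. Qed.
Lemma quot_rel_sym : symmetric quot_rel.
Proof. by move=> x y; rewrite /quot_rel -rpredNS opprB. Qed.
Lemma quot_rel_trans : transitive quot_rel.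
Proof.
by move=> y x z xy yz; rewrite /quot_rel -(subrKA y) rpredD.
Qed.

Canonical quot_equiv :=
  EquivRel quot_rel quot_rel_refl quot_rel_sym quot_rel_trans.

Definition lmod_quot := {eq_quot quot_equiv}.
HB.instance Definition _ := Choice.on lmod_quot.
HB.instance Definition _ := EqQuotient.on lmod_quot.

Implicit Types x y z : V.

Lemma lmod_quot_eqP x y : \pi_lmod_quot x = \pi_lmod_quot y <-> x - y \in S.
Proof. by split=> [/eqmodP|h] //; apply/eqmodP. Qed.

Definition quot0 : lmod_quot := \pi_lmod_quot 0.
Definition quotD (x y : lmod_quot) : lmod_quot := \pi_lmod_quot (repr x + repr y).
Definition quotN (x : lmod_quot) : lmod_quot := \pi_lmod_quot (- repr x).
Definition quotZ a (x : lmod_quot) : lmod_quot := \pi_lmod_quot (a *: repr x).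

Let repr_pi x : repr (\pi_lmod_quot x) - x \in S.
Proof. by apply/lmod_quot_eqP; rewrite reprK. Qed.

Let piD x y : quotD (\pi_lmod_quot x) (\pi_lmod_quot y) = \pi_lmod_quot (x + y).
Proof. by apply/lmod_quot_eqP; rewrite opprD addrACA rpredD ?repr_pi. Qed.
Let piN x : quotN (\pi_lmod_quot x) = \pi_lmod_quot (- x).
Proof. by apply/lmod_quot_eqP; rewrite -opprD rpredNS repr_pi. Qed.
Let piZ a x : quotZ a (\pi_lmod_quot x) = \pi_lmod_quot (a *: x).
Proof. by apply/lmod_quot_eqP; rewrite -scalerBr rpredZ ?repr_pi. Qed.

Let addA : associative quotD.
Proof.
elim/quotW=> x; elim/quotW=> y; elim/quotW=> z.
by rewrite (piD y z) (piD x y) (piD x) piD addrA.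
Qed.
Let addC : commutative quotD.
Proof. by move=> x y; rewrite /quotD addrC. Qed.
Let add0 : left_id quot0 quotD.
Proof. by elim/quotW=> x; rewrite /quot0 piD add0r. Qed.
Let addN : left_inverse quot0 quotN quotD.
Proof. by elim/quotW=> x; rewrite (piN x) piD addNr. Qed.

HB.instance Definition _ := GRing.isZmodule.Build lmod_quot addA addC add0 addN.

Lemma lmod_quotD x y :
  \pi_lmod_quot (x + y) = \pi_lmod_quot x + \pi_lmod_quot y.
Proof. by rewrite -piD. Qed.

Let scaleA a b (x : lmod_quot) : quotZ a (quotZ b x) = quotZ (a * b) x.
Proof. by elim/quotW: x => x; rewrite (piZ b) (piZ a) (piZ (a * b)) scalerA. Qed.
Let scale1 : left_id 1 quotZ.
Proof. by elim/quotW=> x; rewrite (piZ 1) scale1r. Qed.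
Let scaleDr : right_distributive quotZ +%R.
Proof.
move=> a; elim/quotW=> x; elim/quotW=> y.
by rewrite -lmod_quotD (piZ a (x + y)) (piZ a x) (piZ a y) -lmod_quotD scalerDr.
Qed.
Let scaleDl (x : lmod_quot) : {morph quotZ^~ x : a b / a + b}.
Proof.
elim/quotW: x => x a b.
by rewrite (piZ (a + b)) (piZ a) (piZ b) -lmod_quotD scalerDl.
Qed.

HB.instance Definition _ :=
  GRing.Zmodule_isLmodule.Build R lmod_quot scaleA scale1 scaleDr scaleDl.

Lemma lmod_quotZ a x : \pi_lmod_quot (a *: x) = a *: \pi_lmod_quot x.
Proof. by rewrite -piZ. Qed.

End QuotientSpace.

Section GeneratedSubspaces.
Variables (K : fieldType) (E : algType K) (x : E).

Definition gen_subalg : {pred E} := fun y =>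
  `[< forall S : {pred E}, GRing.subalg_closed S -> x \in S -> y \in S >].

Lemma gen_subalgP y : reflect
  (forall S : {pred E}, GRing.subalg_closed S -> x \in S -> y \in S)
  (y \in gen_subalg).
Proof. exact: asboolP. Qed.

Lemma gen_subalg_closed : GRing.subalg_closed gen_subalg.
Proof.
split=> [|a y z /gen_subalgP hy /gen_subalgP hz|y z /gen_subalgP hy /gen_subalgP hz];
  apply/gen_subalgP => S hS xS; have [S1 SZ SM] := hS; first by [].
- exact: SZ (hy S hS xS) (hz S hS xS).
- exact: SM (hy S hS xS) (hz S hS xS).
Qed.

HB.instance Definition _ := GRing.isSubalgClosed.Build K E gen_subalg
  (GRing.subalg_closed_semi gen_subalg_closed).

(* K[x] *)
Definition polyalg := {y : E | y \in gen_subalg}.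
HB.instance Definition _ := SubChoice.on polyalg.
HB.instance Definition _ := [SubChoice_isSubAlgebra of polyalg by <:].

Definition polyalg_incl : polyalg -> E := \val.
HB.instance Definition _ := GRing.RMorphism.copy polyalg_incl
  (\val : polyalg -> E).
Let polyalg_incl_scalable : scalable polyalg_incl.
Proof. by move=> a y; rewrite /polyalg_incl linearZ. Qed.
HB.instance Definition _ :=
  GRing.isScalable.Build K polyalg E *:%R polyalg_incl polyalg_incl_scalable.

(* xE *)
Definition right_ideal : {pred E} := fun y => `[< exists e, y = x * e >].

Lemma right_idealP y : reflect (exists e, y = x * e) (y \in right_ideal).
Proof. exact: asboolP. Qed.

Lemma right_ideal_closed : GRing.submod_closed right_ideal.
Proof.
split=> [|a y z /right_idealP[e ->] /right_idealP[f ->]]; apply/right_idealP.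
  by exists 0; rewrite mulr0.
by exists (a *: e + f); rewrite mulrDr scalerAr.
Qed.

HB.instance Definition _ := GRing.isSubmodClosed.Build K E right_ideal
  (GRing.submod_closed_semi right_ideal_closed).

End GeneratedSubspaces.

Section Coalgebras.
Variable K : fieldType.

Record coalgebra (C : lmodType K) := Coalgebra {
  comul : {linear C -> (C ⊗ C)%type};
  counit : {linear C -> K^o};
  comulA : forall c,
    tassoc (tmap comul idfun (comul c)) = tmap idfun comul (comul c);
  counitl : forall c, tlift (fun a b => counit a *: b) (comul c) = c;
  counitr : forall c, tlift (fun a b => counit b *: a) (comul c) = c
}.

Definition coalgebra_map (C D : lmodType K) (hC : coalgebra C)
    (hD : coalgebra D) (f : {linear C -> D}) : Prop :=
  (forall c, comul hD (f c) = tmap f f (comul hC c)) /\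
  (forall c, counit hD (f c) = counit hC c).

Section Coradical.
Variables (C : lmodType K) (hC : coalgebra C).

(* The second clause says that comul maps D into the image of D ⊗ D. *)
Definition subcoalgebra (D : {pred C}) : Prop :=
  GRing.submod_closed D /\
  {in D, forall c, exists s : seq (C * C),
    {in s, forall p, p.1 \in D /\ p.2 \in D} /\
    comul hC c = \sum_(p <- s) p.1 ⊗ p.2}.

Definition simple_subcoalgebra (D : {pred C}) : Prop :=
  [/\ subcoalgebra D, ~ D =i pred1 0
    & forall D' : {pred C}, subcoalgebra D' -> {subset D' <= D} ->
        D' =i pred1 0 \/ D' =i D].

(* The sum of the simple subcoalgebras. *)
Definition coradical : {pred C} := fun c => `[< exists s : seq C,
  {in s, forall d, exists2 D : {pred C}, simple_subcoalgebra D & d \in D} /\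
  c = \sum_(d <- s) d >].

End Coradical.

Record hopf_algebra (A : algType K) := HopfAlgebra {
  hopf_coalgebra :> coalgebra A;
  comul_monoid : GRing.monoid_morphism (comul hopf_coalgebra);
  counit_monoid : GRing.monoid_morphism (counit hopf_coalgebra);
  antipode : {linear A -> A};
  antipodel : forall a,
    tlift (fun b c => antipode b * c) (comul hopf_coalgebra a)
      = (counit hopf_coalgebra a)%:A;
  antipoder : forall a,
    tlift (fun b c => b * antipode c) (comul hopf_coalgebra a)
      = (counit hopf_coalgebra a)%:A
}.

Definition connected (A : algType K) (hA : hopf_algebra A) : Prop :=
  forall a, a \in coradical hA <-> exists k : K, a = k%:A.

Definition primitive (A : algType K) (hA : hopf_algebra A) (x : A) : Prop :=
  comul hA x = x ⊗ 1 + 1 ⊗ x.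

(* Since K is a field, i ⊗ i is injective when i is, so hH is determined by hA
   and i: it is the restriction of the structure of A to the image of i. *)
Definition hopf_subalgebra (H A : algType K) (hH : hopf_algebra H)
    (hA : hopf_algebra A) (i : {lrmorphism H -> A}) : Prop :=
  [/\ injective i, coalgebra_map hH hA i
    & forall h, i (antipode hH h) = antipode hA (i h)].

Definition weak_projection (H A : algType K) (hH : hopf_algebra H)
    (hA : hopf_algebra A) (i : {lrmorphism H -> A}) (p : {linear A -> H}) :
    Prop :=
  [/\ hopf_subalgebra hH hA i, cancel i p,
      forall h a, p (i h * a) = h * p a & coalgebra_map hA hH p].

End Coalgebras.

(* Main.v *)
Require Import Defs.
From HB Require Import structures.
From mathcomp Require Import all_boot all_algebra boolp.
From mathcomp Require classical_sets.
Set Implicit Arguments.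
Unset Strict Implicit.
Unset Printing Implicit Defensive.
Import GRing.Theory.
Local Open Scope ring_scope.

(* The dual algebra of E acts on E by f . c = f(c_1) c_2. If E is connected, every
   element is killed by a power of the ideal m of functionals vanishing at 1: otherwise
   some finite-dimensional orbit is simple modulo the conilpotent elements, and its
   coefficients form a simple subcoalgebra other than K1.

   Since x is primitive, left multiplication by x is a coderivation. If g(1) = 0 and
   g(x) = 1, the commutator of the actions of g and x is 1 modulo terms of lower degree
   in the coradical filtration, so in characteristic 0 left multiplication by x is
   injective. Hence there is a functional f with f(1) = 0 and f(xc) = eps(c), and its
   action D satisfies D(xc) = x D(c) + c and is locally nilpotent. The weak projection is
   c |-> sum_n eps(D^n c) x^n / n!, and E = K[x] (x) E/xE is the usual splitting of a
   module over the Weyl algebra on which D is locally nilpotent: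
   c |-> sum_n x^n / n! (x) [D^n c]. *)

(** * Subspaces and functionals *)

Section Subspaces.
Variables (K : fieldType) (V : lmodType K).
Implicit Types (S : V -> Prop) (u v : V) (a : K).

Definition subspace S := S 0 /\ forall a u v, S u -> S v -> S (a *: u + v).

Section Closure.
Variable S : V -> Prop.
Hypothesis subS : subspace S.

Lemma subspace0 : S 0. Proof. by case: subS. Qed.

Lemma subspaceZ a u : S u -> S (a *: u).
Proof. by move=> Su; rewrite -[_ *: _]addr0; apply: subS.2 => //; case: subS. Qed.

Lemma subspaceD u v : S u -> S v -> S (u + v).
Proof. by rewrite -{2}[u]scale1r; apply: subS.2. Qed.

Lemma subspaceN u : S u -> S (- u).
Proof. by rewrite -scaleN1r; apply: subspaceZ. Qed.

Lemma subspaceB u v : S u -> S v -> S (u - v).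
Proof. by move=> Su /subspaceN; apply: subspaceD. Qed.

Lemma subspace_sum I (r : seq I) (P : pred I) (F : I -> V) :
  (forall i, P i -> S (F i)) -> S (\sum_(i <- r | P i) F i).
Proof. by apply: big_ind; [exact: subspace0 | exact: subspaceD]. Qed.

Lemma subspace_sum_seq (I : eqType) (r : seq I) (F : I -> V) :
  {in r, forall i, S (F i)} -> S (\sum_(i <- r) F i).
Proof. by move=> rS; rewrite big_seq; apply: subspace_sum. Qed.

End Closure.

(** Zorn's lemma gives a subspace T maximal among those that contain S and avoid v. It is a
    complement of the line of v, and f reads off the coefficient of v. *)
Lemma separating_functional S v : subspace S -> ~ S v ->
  exists2 f : {linear V -> K^o}, (forall u, S u -> f u = 0) & f v = 1.
Proof.
move=> subS Sv; pose P T := [/\ subspace T, forall u, S u -> T u & ~ T v].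
(* The empty set is allowed because it is the union of the empty chain. *)
pose Q (T : V -> Prop) := (forall u, ~ T u) \/ P T.
have [|T [PT maxT]] := @classical_sets.Zorn_bigcup _ Q.
  move=> F FQ Ftot.
  have [[T0 FT0 PT0]|noP] := pselect (exists2 T, F T & P T); last first.
    by left=> u [T FT Tu]; case: (FQ T FT) => [/(_ u)//|PT]; apply: noP; exists T.
  have chain T u : F T -> T u -> P T.
    by move=> FT Tu; case: (FQ T FT) => // /(_ u).
  right; split=> [|u Su|[T FT Tv]].
  - split; first by exists T0 => //; case: PT0 => -[].
    move=> a u w [T1 FT1 T1u] [T2 FT2 T2w].
    have [T12|T21] := Ftot _ _ FT1 FT2.
      exists T2 => //; have [[_ h] _ _] := chain _ _ FT2 T2w.
      by apply: h => //; apply: T12.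
    exists T1 => //; have [[_ h] _ _] := chain _ _ FT1 T1u.
    by apply: h => //; apply: T21.
  - by exists T0 => //; case: PT0 => _ h _; apply: h.
  by have [_ _] := chain _ _ FT Tv; apply.
have {}PT : P T.
  case: PT => // T0; exfalso; apply: (maxT S); last by right; split.
  by split=> [u /T0//|ST]; apply: (T0 0); apply: ST; apply: subspace0.
have [subT ST Tv] := PT.
(* If u lies outside T, then [T'], which is T + Ku, is strictly larger than T. By maximality it
   contains v, with a nonzero coefficient of u. *)
have decomp u : exists a, T (u - a *: v).
  have [Tu|Tu] := pselect (T u); first by exists 0; rewrite scale0r subr0.
  pose T' w := exists a, T (w - a *: u).
  have [[a Ta]|T'v] := pselect (T' v).
    have a0 : a != 0.
      by apply: contra_notN Tv => /eqP a0; rewrite a0 scale0r subr0 in Ta.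
    exists a^-1; rewrite -opprB; apply: subspaceN => //.
    rewrite -[u in _ - u]scale1r -(mulVf a0) -scalerA -scalerBr.
    exact: subspaceZ.
  exfalso; apply: (maxT T'); last first.
    right; split=> // [|w Sw]; last by exists 0; rewrite scale0r subr0; apply: ST.
    split; first by exists 0; rewrite scale0r subr0; apply: subspace0.
    move=> a w1 w2 [a1 h1] [a2 h2]; exists (a * a1 + a2).
    rewrite scalerDl opprD addrACA -scalerA -scalerBr.
    exact: subT.2.
  split=> [w Tw|T'T]; first by exists 0; rewrite scale0r subr0.
  by apply: Tu; apply: T'T; exists 1; rewrite scale1r subrr; apply: subspace0.
have uniq u a b : T (u - a *: v) -> T (u - b *: v) -> a = b.
  move=> Ta Tb; apply/eqP; rewrite -subr_eq0; apply: contra_notT Tv => ab.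
  rewrite -[v]scale1r -(mulVf ab) -scalerA; apply: subspaceZ => //.
  have -> : (a - b) *: v = (u - b *: v) - (u - a *: v).
    by rewrite opprB [RHS]addrC addrA subrK scalerBl.
  exact: subspaceB.
have [f fP] := choice decomp.
have f_lin : linear (f : V -> K^o).
  move=> a u w; apply: (uniq (a *: u + w)) => //.
  by rewrite scalerDl opprD addrACA -scalerA -scalerBr; apply: subT.2.
pose f' : {linear V -> K^o} := HB.pack f (GRing.isLinear.Build _ _ _ _ f f_lin).
exists f' => [u Su|]; [apply: (uniq u) => //|apply: (uniq v) => //=].
  by rewrite scale0r subr0; apply: ST.
by rewrite scale1r subrr; apply: subspace0.
Qed.

(** Coefficients form a row vector so that sets of coefficients can be handled as a [{vspace}]. *)
Definition spanned n (w : 'I_n -> V) v := exists a : 'rV[K]_n, v = \sum_i a 0 i *: w i.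

Lemma spanned_subspace n (w : 'I_n -> V) : subspace (spanned w).
Proof.
split; first by exists 0; rewrite big1 // => i _; rewrite mxE scale0r.
move=> a u v [c ->] [d ->]; exists (a *: c + d).
rewrite scaler_sumr -big_split; apply: eq_bigr => i _.
by rewrite !mxE scalerDl scalerA.
Qed.

Lemma spanned_mem n (w : 'I_n -> V) i : spanned w (w i).
Proof.
exists (delta_mx 0 i); rewrite (bigD1 i) //= big1 => [|j ji].
  by rewrite mxE !eqxx scale1r addr0.
by rewrite mxE eqxx (negPf ji) scale0r.
Qed.

Lemma spanned_least n (w : 'I_n -> V) S v :
  subspace S -> (forall i, S (w i)) -> spanned w v -> S v.
Proof.
by move=> subS Sw [a ->]; apply: subspace_sum => // i _; apply: subspaceZ.
Qed.

End Subspaces.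

(** A subspace of maximal dimension inside S is all of S: adding the line of a vector of S stays
    inside S, so it cannot raise the dimension. *)
Lemma subspace_vspace (K : fieldType) n (S : 'rV[K]_n -> Prop) :
  subspace S -> exists U : {vspace 'rV[K]_n}, forall v, S v <-> v \in U.
Proof.
move=> subS; pose P k := `[< exists2 U : {vspace 'rV[K]_n},
  \dim U = k & forall v, v \in U -> S v >].
have P0 : exists k, P k.
  exists 0%N; apply/asboolP; exists 0%VS; first by rewrite dimv0.
  by move=> v; rewrite memv0 => /eqP->; apply: subspace0.
have Pn k : P k -> (k <= \dim {:'rV[K]_n})%N.
  by move=> /asboolP[U <- _]; apply/dimvS/subvf.
case: (ex_maxnP P0 Pn) => k /asboolP[U dimU US] maxk.
exists U => v; split=> [Sv|/US //].
have : P (\dim (U + <[v]>)%VS).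
  apply/asboolP; exists (U + <[v]>)%VS => // _ /memv_addP[u uU [_ /vlineP[a ->] ->]].
  by rewrite addrC; apply: subS.2 => //; apply: US.
move=> /maxk; rewrite -dimU => le_dim.
have /eqP-> : U == (U + <[v]>)%VS by rewrite eqEdim addvSl.
by apply: (subvP (addvSr U <[v]>)); apply: memv_line.
Qed.

(** S is pulled back to a subspace U of the coefficient space, and the images of a basis of U span
    S. Since k is the dimension of U, k = n makes U everything; [minimal_orbit] relies on this last
    clause. *)
Lemma subspace_spanned (K : fieldType) (V : lmodType K) (S : V -> Prop) n
    (w : 'I_n -> V) :
    subspace S -> (forall v, S v -> spanned w v) ->
  exists k (w' : 'I_k -> V), [/\ forall i, S (w' i), forall v, S v -> spanned w' v,
    (k <= n)%N & k = n -> forall v, spanned w v -> S v].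
Proof.
move=> subS Sw; pose L (a : 'rV[K]_n) := \sum_i a 0 i *: w i.
have L_lin : linear L.
  move=> a c d; rewrite scaler_sumr -big_split; apply: eq_bigr => i _.
  by rewrite !mxE scalerDl scalerA.
pose L' : {linear _ -> V} := HB.pack L (GRing.isLinear.Build _ _ _ _ L L_lin).
have [|U US] := @subspace_vspace K n (S \o L).
  split=> [|a c d Sc Sd] /=.
    by rewrite (linear0 L' : L 0 = 0); case: subS.
  by rewrite L_lin; apply: subS.2.
have dimE : \dim {:'rV[K]_n} = n. by rewrite dimvf; apply: mul1n.
exists (\dim U), (fun i => L (vbasis U)`_i); split=> [i|v Sv||dimU v [a ->]].
- by apply/US/vbasis_mem/mem_nth; rewrite size_tuple.
- have [a va] := Sw v Sv; have aU : a \in U by apply/US; rewrite /= /L -va.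
  exists (\row_i coord (vbasis U) i a).
  rewrite va -[LHS]/(L' a) {1}(coord_vbasis aU) linear_sum.
  apply: eq_bigr => i _.
  by rewrite mxE linearZ.
- by rewrite -[leqRHS]dimE dimvS ?subvf.
have /eqP UT : U == fullv by rewrite eqEdim subvf dimE dimU /=.
by apply/(US a); rewrite UT memvf.
Qed.

(** * Tensor products and contractions *)

HB.instance Definition _ (R : comNzRingType) (V V' W W' : lmodType R)
    (f : {linear V -> V'}) (g : {linear W -> W'}) :=
  GRing.isLinear.Build R (V ⊗ W)%type (V' ⊗ W')%type *:%R (tmap f g)
    (tmap_linear f g).

HB.instance Definition _ (R : comNzRingType) (V W U : lmodType R) :=
  GRing.isLinear.Build R ((V ⊗ W) ⊗ U)%type (V ⊗ (W ⊗ U))%type *:%R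
    (@tassoc R V W U) (@tassoc_linear R V W U).

Section TensorFacts.
Variable R : comNzRingType.
Implicit Types V W U : lmodType R.

Lemma linear_tensor_sum V W U (F : {linear (V ⊗ W)%type -> U}) t :
  F t = \sum_(p <- repr t) F (p.1 ⊗ p.2).
Proof. by rewrite {1}[t]tensorE linear_sum. Qed.

Lemma tens0l V W (w : W) : (0 : V) ⊗ w = 0.
Proof. by rewrite -[0 in LHS](scale0r 0) tensZl scale0r. Qed.

Lemma tens0r V W (v : V) : v ⊗ (0 : W) = 0.
Proof. by rewrite -[0 in LHS](scale0r 0) tensZr scale0r. Qed.

Lemma tens_suml V W I r (P : pred I) (F : I -> V) (w : W) :
  (\sum_(i <- r | P i) F i) ⊗ w = \sum_(i <- r | P i) F i ⊗ w.
Proof. by apply: (big_morph (fun v => v ⊗ w)) => [u v|]; rewrite ?tensDl ?tens0l. Qed.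

Lemma tens_sumr V W I r (P : pred I) (F : I -> W) (v : V) :
  v ⊗ (\sum_(i <- r | P i) F i) = \sum_(i <- r | P i) v ⊗ F i.
Proof. by apply: (big_morph (fun w => v ⊗ w)) => [u w|]; rewrite ?tensDr ?tens0r. Qed.

Lemma tmap_comp V V' V'' W W' W'' (f : {linear V -> V'}) (f' : {linear V' -> V''})
    (g : {linear W -> W'}) (g' : {linear W' -> W''}) t :
  tmap f' g' (tmap f g t) = tmap (f' \o f) (g' \o g) t.
Proof.
apply: (tensor_ext (f := tmap f' g' \o tmap f g)) => [||v w].
- exact: linearP.
- exact: linearP.
by rewrite /= !tmapE.
Qed.

Lemma tmap_id V W t : tmap (@idfun V) (@idfun W) t = t.
Proof. by apply: (tensor_ext (g := idfun)) => [||v w] //; [apply: linearP|rewrite tmapE]. Qed.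

Lemma tmap_cancel V V' W W' (f : {linear V -> V'}) (f' : {linear V' -> V})
    (g : {linear W -> W'}) (g' : {linear W' -> W}) :
  cancel f f' -> cancel g g' -> cancel (tmap f g) (tmap f' g').
Proof.
move=> fK gK t; rewrite tmap_comp -[RHS]tmap_id.
by congr (tmap _ _ t); apply/funext => v /=; rewrite ?fK ?gK.
Qed.


Lemma tensor_lift V W U (b : V -> W -> U) : bilinear_for *:%R *:%R b ->
  exists F : {linear (V ⊗ W)%type -> U}, forall v w, F (v ⊗ w) = b v w.
Proof.
move=> b_bilin; pose F : {linear (V ⊗ W)%type -> U} :=
  HB.pack (tlift b) (GRing.isLinear.Build _ _ _ _ (tlift b) (tlift_linear b_bilin)).
by exists F => v w; apply: tliftE.
Qed.

Lemma tlift_sum V W U (b : V -> W -> U) I r (P : pred I) (F : I -> V) (G : I -> W) :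
  bilinear_for *:%R *:%R b ->
  tlift b (\sum_(i <- r | P i) F i ⊗ G i) = \sum_(i <- r | P i) b (F i) (G i).
Proof.
move=> b_bilin; pose B : {linear (V ⊗ W)%type -> U} :=
  HB.pack (tlift b) (GRing.isLinear.Build _ _ _ _ (tlift b) (tlift_linear b_bilin)).
rewrite -[LHS]/(B _) linear_sum; apply: eq_bigr => i _; exact: tliftE.
Qed.

Lemma tmap_sum V V' W W' (f : {linear V -> V'}) (g : {linear W -> W'})
    I r (P : pred I) (F : I -> V) (G : I -> W) :
  tmap f g (\sum_(i <- r | P i) F i ⊗ G i) = \sum_(i <- r | P i) f (F i) ⊗ g (G i).
Proof. exact/tlift_sum/tmap_bilinear. Qed.

Lemma scale_bilinl V W (f : {linear V -> R^o}) :
  bilinear_for *:%R *:%R (fun (v : V) (w : W) => f v *: w).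
Proof.
split=> [w|v] a x y /=; first by rewrite linearP scalerDl scalerA.
by rewrite scalerDr !scalerA mulrC.
Qed.

Lemma scale_bilinr V W (f : {linear W -> R^o}) :
  bilinear_for *:%R *:%R (fun (v : V) (w : W) => f w *: v).
Proof.
split=> [w|v] a x y /=; last by rewrite linearP scalerDl scalerA.
by rewrite scalerDr !scalerA mulrC.
Qed.

End TensorFacts.
Arguments scale_bilinl {R V W} f.
Arguments scale_bilinr {R V W} f.

Section MinimalRepresentation.
Variables (K : fieldType) (V W : lmodType K).
Implicit Types t : (V ⊗ W)%type.

(** Substituting v_i = sum_j a_j v_j merges the i-th term into the others. *)
Lemma tensor_dropl n (v : 'I_n -> V) (w : 'I_n -> W) i :
    spanned (fun j => v (lift i j)) (v i) ->
  exists (v' : 'I_n.-1 -> V) (w' : 'I_n.-1 -> W),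
    \sum_j v j ⊗ w j = \sum_j v' j ⊗ w' j.
Proof.
move=> [a vi]; exists (fun j => v (lift i j)), (fun j => w (lift i j) + a 0 j *: w i).
rewrite (bigD1_ord i) //= vi tens_suml -big_split /=.
by apply: eq_bigr => j _; rewrite tensDr tensZr tensZl addrC.
Qed.

Lemma tensor_dropr n (v : 'I_n -> V) (w : 'I_n -> W) i :
    spanned (fun j => w (lift i j)) (w i) ->
  exists (v' : 'I_n.-1 -> V) (w' : 'I_n.-1 -> W),
    \sum_j v j ⊗ w j = \sum_j v' j ⊗ w' j.
Proof.
move=> [a wi]; exists (fun j => v (lift i j) + a 0 j *: v i), (fun j => w (lift i j)).
rewrite (bigD1_ord i) //= wi tens_sumr -big_split /=.
by apply: eq_bigr => j _; rewrite tensDl tensZr tensZl addrC.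
Qed.

Lemma dual_functional n (v : 'I_n -> V) i :
    ~ spanned (fun j => v (lift i j)) (v i) ->
  exists f : {linear V -> K^o}, forall j, f (v j) = (i == j)%:R.
Proof.
move=> /(separating_functional (@spanned_subspace _ _ _ _))[f f0 f1].
exists f => j; case: (unliftP i j) => [j' ->|->]; last by rewrite eqxx.
by rewrite (negPf (neq_lift _ _)) f0 //; apply: (@spanned_mem _ _ _ (fun j => _)).
Qed.

End MinimalRepresentation.

(** In a shortest expression no factor is a combination of the others on its side, as its term could
    then be dropped. Hence both families have dual functionals. *)
Lemma tensor_minimal (K : fieldType) (V W : lmodType K) (t : (V ⊗ W)%type) :
  exists n (v : 'I_n -> V) (w : 'I_n -> W), [/\ t = \sum_j v j ⊗ w j,
    forall i, exists f : {linear V -> K^o}, forall j, f (v j) = (i == j)%:R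
    & forall i, exists f : {linear W -> K^o}, forall j, f (w j) = (i == j)%:R].
Proof.
pose P n := `[< exists (v : 'I_n -> V) (w : 'I_n -> W), t = \sum_j v j ⊗ w j >].
have exP : exists n, P n.
  exists (size (repr t)); apply/asboolP.
  exists (fun j => (nth (0, 0) (repr t) j).1), (fun j => (nth (0, 0) (repr t) j).2).
  by rewrite {1}[t]tensorE (big_nth (0, 0)) big_mkord.
case: (ex_minnP exP) => n /asboolP[v [w tE]] minn.
(* The mere existence of i forces n > 0, so that n.-1 is smaller than n. *)
have lt_absurd (i : 'I_n) : P n.-1 -> False.
  by case: n {v w tE} minn i => [_ []//|n] minn _ /minn; rewrite ltnn.
exists n, v, w; split=> // i; apply: dual_functional.
  move=> /(tensor_dropl w)[v' [w' E]]; apply: (lt_absurd i).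
  by apply/asboolP; exists v', w'; rewrite tE.
move=> /(tensor_dropr v)[v' [w' E]]; apply: (lt_absurd i).
by apply/asboolP; exists v', w'; rewrite tE.
Qed.

Section Contractions.
Variables (K : fieldType) (C : lmodType K) (hC : coalgebra C).
Implicit Types (f g : {linear C -> K^o}) (c : C).

(* In Sweedler notation, [contl f c] is f(c_1) c_2 and [contr f c] is f(c_2) c_1. *)
Definition contl (f : C -> K^o) c : C := tlift (fun a b => f a *: b) (comul hC c).
Definition contr (f : C -> K^o) c : C := tlift (fun a b => f b *: a) (comul hC c).

Lemma contl_linear f : linear (contl f).
Proof. by move=> a c d; rewrite /contl linearP (tlift_linear (scale_bilinl f)). Qed.

Lemma contr_linear f : linear (contr f).
Proof. by move=> a c d; rewrite /contr linearP (tlift_linear (scale_bilinr f)). Qed.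

HB.instance Definition _ f :=
  GRing.isLinear.Build K C C *:%R (contl f) (contl_linear f).
HB.instance Definition _ f :=
  GRing.isLinear.Build K C C *:%R (contr f) (contr_linear f).

Lemma contlE f c I r (P : pred I) F G :
  comul hC c = \sum_(i <- r | P i) F i ⊗ G i ->
  contl f c = \sum_(i <- r | P i) f (F i) *: G i.
Proof. by rewrite /contl => ->; apply/tlift_sum/scale_bilinl. Qed.

Lemma contrE f c I r (P : pred I) F G :
  comul hC c = \sum_(i <- r | P i) F i ⊗ G i ->
  contr f c = \sum_(i <- r | P i) f (G i) *: F i.
Proof. by rewrite /contr => ->; apply/tlift_sum/scale_bilinr. Qed.

Lemma contl_counit c : contl (counit hC) c = c.
Proof. exact: counitl. Qed.

Lemma counit_contr f c : counit hC (contr f c) = f c.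
Proof.
rewrite -{2}(counitl hC c) /contr /tlift !linear_sum; apply: eq_bigr => p _ /=.
by rewrite !linearZ; apply: mulrC.
Qed.

Lemma counit_contl f c : counit hC (contl f c) = f c.
Proof.
rewrite -{2}(counitr hC c) /contl /tlift !linear_sum; apply: eq_bigr => p _ /=.
by rewrite !linearZ; apply: mulrC.
Qed.

Lemma contl_contr f g c : g (contl f c) = f (contr g c).
Proof.
rewrite /contl /contr /tlift !linear_sum; apply: eq_bigr => p _ /=.
by rewrite !linearZ; apply: mulrC.
Qed.

(** By coassociativity both sides are f(c_1) c_2 ⊗ c_3. The map F of the proof applies f to the
    first of three factors. *)
Lemma comul_contl f c : comul hC (contl f c) = tmap (contl f) idfun (comul hC c).
Proof.
have [F FE] := tensor_lift (@scale_bilinl K C (C ⊗ C)%type f).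
have E : \sum_(p <- repr (comul hC c)) F (tassoc (comul hC p.1 ⊗ p.2))
       = \sum_(p <- repr (comul hC c)) F (p.1 ⊗ comul hC p.2).
  transitivity ((F \o tassoc \o tmap (comul hC) idfun) (comul hC c)).
    by rewrite linear_tensor_sum; apply: eq_bigr => p _; rewrite /= tmapE.
  rewrite /= comulA -[LHS]/((F \o tmap idfun (comul hC)) (comul hC c)).
  by rewrite linear_tensor_sum; apply: eq_bigr => p _; rewrite /= tmapE.
rewrite {1}/contl /tlift linear_sum linear_tensor_sum.
transitivity (\sum_(p <- repr (comul hC c)) F (p.1 ⊗ comul hC p.2)).
  by apply: eq_bigr => p _; rewrite linearZ FE.
rewrite -E; apply: eq_bigr => p _.
rewrite /= tmapE {1}[comul hC p.1]tensorE tens_suml.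
rewrite (linear_sum tassoc) (linear_sum F) /contl /tlift tens_suml.
by apply: eq_bigr => q _; rewrite /= tassocE FE tensZl.
Qed.

(** The functional [g \o contl f] is the convolution product f(c_1) g(c_2), so contraction is an
    action of the dual algebra. *)
Lemma contl_comp f g c : contl g (contl f c) = contl (g \o contl f) c.
Proof.
have E : comul hC (contl f c) = \sum_(p <- repr (comul hC c)) contl f p.1 ⊗ p.2.
  by rewrite comul_contl linear_tensor_sum; apply: eq_bigr => p _; rewrite /= tmapE.
by rewrite (contlE _ E).
Qed.

End Contractions.

(** * Subcoalgebras and simple modules over the dual algebra *)

Section ContractionCombination.
Variables (K : fieldType) (C : lmodType K) (hC : coalgebra C).
Implicit Types (f g h : {linear C -> K^o}) (c : C).

Lemma contl_combination a f g h c : (forall d, h d = a * f d + g d) ->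
  contl hC h c = a *: contl hC f c + contl hC g c.
Proof.
move=> hE; rewrite /contl /tlift scaler_sumr -big_split.
by apply: eq_bigr => p _; rewrite hE scalerDl scalerA.
Qed.

Lemma contl_orbit_subspace c : subspace (fun d => exists f, d = contl hC f c).
Proof.
split; first by exists \0; rewrite /contl /tlift big1 // => p _; rewrite scale0r.
move=> a _ _ [f ->] [g ->]; exists (a \*: f \+ g).
by rewrite [RHS](@contl_combination a f g).
Qed.

(** If comul c is the sum of the v_i ⊗ w_i, then f . c is the sum of the f(v_i) w_i. This is the
    finiteness on which all the minimality arguments below rest. *)
Lemma contl_orbit_spanned c : exists n (w : 'I_n -> C),
  forall f, spanned w (contl hC f c).
Proof.
have [n [v [w [cE _ _]]]] := tensor_minimal (comul hC c).
exists n, w => f; rewrite (contlE _ cE).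
have subw := spanned_subspace w; apply: subspace_sum => // i _.
by apply: subspaceZ => //; apply: spanned_mem.
Qed.

(* Sub-bimodules for the two actions of the dual algebra. *)
Definition contraction_stable (D : C -> Prop) :=
  forall f c, D c -> D (contl hC f c) /\ D (contr hC f c).

(** For the converse, write comul c in minimal form: contracting with dual functionals extracts each
    single factor, which therefore lies in D. *)
Lemma subcoalgebraP (D : {pred C}) : subcoalgebra hC D <->
  subspace (fun c => c \in D) /\ contraction_stable (fun c => c \in D).
Proof.
split=> -[subD cD]; split=> //.
  move=> f c /cD[s [sD cE]]; split; [rewrite (contlE f cE)|rewrite (contrE f cE)];
    by apply: (subspace_sum_seq subD) => p /sD[? ?]; apply: (subspaceZ subD).
move=> c Dc; have [n [v [w [cE dv dw]]]] := tensor_minimal (comul hC c).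
exists [seq (v i, w i) | i <- enum 'I_n]; split; last first.
  by rewrite big_map cE big_enum.
move=> _ /mapP[i _ ->]; split.
  have [f fE] := dw i; have := (cD f c Dc).2; rewrite (contrE f cE) (bigD1 i) //=.
  rewrite fE eqxx scale1r big1 ?addr0 // => j ji.
  by rewrite fE eq_sym (negPf ji) scale0r.
have [f fE] := dv i; have := (cD f c Dc).1; rewrite (contlE f cE) (bigD1 i) //=.
rewrite fE eqxx scale1r big1 ?addr0 // => j ji.
by rewrite fE eq_sym (negPf ji) scale0r.
Qed.

Definition annihilates f (D : C -> Prop) := forall c, D c -> f c = 0.

(* The submodule generated by [d] for the action contl is simple modulo [N]. *)
Section SimpleModule.
Variables (N : C -> Prop) (d : C).
Hypothesis subN : subspace N.
Hypothesis N_contl : forall f c, N c -> N (contl hC f c).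
Hypothesis d_simple :
  forall f, ~ N (contl hC f d) -> exists g, contl hC g (contl hC f d) = d.

(** The functionals annihilating D form a two-sided ideal that acts nontrivially on a simple module.
    As in the density theorem, some element of it acts as the identity on a given finite list. *)
Lemma annihilator_fixes D f0 (es : seq C) :
    contraction_stable D -> annihilates f0 D -> ~ N (contl hC f0 d) ->
    {in es, forall e, exists f, e = contl hC f d} ->
  exists2 f, annihilates f D & {in es, forall e, N (contl hC f e - e)}.
Proof.
move=> stD f0D Nf0 .
have one e : (exists f, e = contl hC f d) ->
    exists2 f, annihilates f D & N (contl hC f e - e).
  move=> [f eE]; have [Ne|Ne] := pselect (N e).
    exists \0; first by [].
    by apply: subspaceB => //; apply: N_contl.
  rewrite eE in Ne; have [g ge] := d_simple Ne; have [g' g'd] := d_simple Nf0.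
  (* This product acts by e -> d -> f0 . d -> d -> f . d = e; the factor f0 puts it into the
     ideal. *)
  exists (f \o contl hC (g' \o contl hC (f0 \o contl hC g))).
    move=> c Dc /=; rewrite contl_contr /= contl_contr /= f0D //.
    by apply: (stD _ _ _).1; apply: (stD _ _ _).2; apply: (stD _ _ _).2.
  rewrite -!contl_comp eE ge g'd subrr; exact: subspace0.
elim: es => [|e es IHes] esP; first by exists \0.
have [|f fD fes] := IHes; first by move=> e' e'es; apply: esP; rewrite inE e'es orbT.
have [|f' f'D f'e] := one (e - contl hC f e).
  have [h eE] := esP e (mem_head _ _); have subo := contl_orbit_subspace d.
  by apply: (subspaceB subo); [exists h|exists (f \o contl hC h); rewrite -contl_comp -eE].
(* The action of this functional is 1 - (1 - f')(1 - f): f settles the tail, and f' fixes e - f . e,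
   the defect left at e. *)
exists ((f \+ f') \- (f' \o contl hC f)).
  move=> c Dc; have Dc' := (stD f' c Dc).2.
  by rewrite /= contl_contr !fD // f'D // addr0 subrr.
have E e' : contl hC ((f \+ f') \- (f' \o contl hC f)) e' - e' =
    (contl hC f e' - e') + contl hC f' (e' - contl hC f e').
  rewrite (@contl_combination (-1) (f' \o contl hC f) (f \+ f')
    ((f \+ f') \- (f' \o contl hC f))); last first.
    by move=> x /=; rewrite mulN1r addrC.
  rewrite (@contl_combination 1 f f' (f \+ f')) => [|x]; last by rewrite /= mul1r.
  rewrite -contl_comp linearB scaleN1r scale1r /=.
  rewrite -!addrA addrC -!addrA; congr (_ + _).
  by rewrite addrC -addrA; congr (_ + _); rewrite addrC.
move=> e'; rewrite inE E => /predU1P[->|e'es].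
  by rewrite addrC -[contl hC f e - e]opprB.
apply: subspaceD => //; first exact: fes.
by apply: N_contl; rewrite -opprB; apply: subspaceN => //; apply: fes.
Qed.

Lemma annihilator_unit D f0 :
    contraction_stable D -> annihilates f0 D -> ~ N (contl hC f0 d) ->
  exists2 f, annihilates f D &
    forall g, N (contl hC f (contl hC g d) - contl hC g d).
Proof.
move=> stD f0D Nf0; have [n [w wd]] := contl_orbit_spanned d.
have [|k [w' [w'd dw' _ _]]] := subspace_spanned (w := w) (contl_orbit_subspace d).
  by move=> _ [f ->].
have [|f fD fes] := @annihilator_fixes D f0 (codom w') stD f0D Nf0.
  by move=> _ /codomP[i ->].
exists f => // g; have [|a ->] := dw' (contl hC g d); first by exists g.
rewrite linear_sum -sumrB; apply: subspace_sum => // i _.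
by rewrite linearZ -scalerBr; apply: subspaceZ => //; apply/fes/codom_f.
Qed.

(** The coalgebra of matrix coefficients of the module generated by d modulo N, encoded as the
    orthogonal of the ideal of functionals that kill this module. *)
Definition coefficient_coalgebra c :=
  forall f, (forall g, N (contl hC f (contl hC g d))) -> f c = 0.

Lemma coefficient_coalgebra_subspace : subspace coefficient_coalgebra.
Proof.
split=> [f _|a u v Iu Iv f fI]; first exact: linear0.
by rewrite linearP Iu // Iv // scaler0 addr0.
Qed.

Lemma coefficient_coalgebra_stable : contraction_stable coefficient_coalgebra.
Proof.
move=> h c Ic; split=> f fI.
  apply: (Ic (f \o contl hC h)) => g.
  by rewrite -contl_comp (contl_comp hC g h d); apply: fI.
rewrite -contl_contr; apply: (Ic (h \o contl hC f)) => g.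
by rewrite -contl_comp; apply: N_contl.
Qed.

(** The witness is the matrix coefficient f |-> th(f . d) for a functional th with th(N) = 0 and
    th(d) = 1. *)
Lemma coefficient_coalgebra_neq0 : ~ N d ->
  exists2 c, coefficient_coalgebra c & counit hC c <> 0.
Proof.
move=> /(separating_functional subN)[th thN thd].
exists (contr hC th d) => [f fI|]; last by rewrite counit_contr thd; apply/eqP/oner_neq0.
by rewrite -contl_contr thN // -[d](contl_counit hC).
Qed.

(** Let D be a smaller subcoalgebra. Either some functional annihilating D moves d outside N, and
    then D = 0, or all of them kill the module, and then D is the whole coefficient coalgebra. *)
Lemma coefficient_coalgebra_simple : ~ N d ->
  simple_subcoalgebra hC (fun c => `[< coefficient_coalgebra c >]).
Proof.
move=> Nd; set I : {pred C} := fun c => _.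
have inI c : (c \in I) = `[< coefficient_coalgebra c >] by [].
split.
- apply/subcoalgebraP; split.
    have [I0 I2] := coefficient_coalgebra_subspace.
    split; first by rewrite inI; apply/asboolP.
    by move=> a u v; rewrite !inI => /asboolP Iu /asboolP Iv; apply/asboolP/I2.
  move=> f c; rewrite !inI => /asboolP Ic.
  by have [? ?] := coefficient_coalgebra_stable f Ic; split; apply/asboolP.
- have [c Ic c0] := coefficient_coalgebra_neq0 Nd.
  move=> /(_ c); rewrite inI inE; have -> := asboolT Ic.
  by move=> /esym/eqP c_eq0; rewrite c_eq0 linear0 in c0.
move=> D coD DI; have [subD stD] := (subcoalgebraP D).1 coD.
have [[f0 f0D Nf0]|noN] := pselect
    (exists2 f, annihilates f (fun c => c \in D) & ~ N (contl hC f d)).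
  have [f fD fN] := annihilator_unit stD f0D Nf0.
  (* Since f acts as the identity modulo N, f - eps kills the module and so vanishes on D, where f
     is zero already. *)
  have eps_D c : c \in D -> counit hC c = 0.
    move=> Dc; have := DI c Dc; rewrite inI => /asboolP/(_ (f \- counit hC)) /=.
    rewrite fD // sub0r => /(_ _)/eqP h; apply/eqP; rewrite -oppr_eq0; apply: h => g.
    rewrite (@contl_combination (-1) (counit hC) f (f \- counit hC)).
      by rewrite scaleN1r contl_counit addrC.
    by move=> x; rewrite mulN1r addrC.
  left=> c; rewrite inE; apply/idP/eqP => [Dc|->]; last exact: (subspace0 subD).
  have [s [sD cE]] := coD.2 c Dc.
  rewrite -(contl_counit hC c) (contlE _ cE) big_seq big1 // => p /sD[p1 _].
  by rewrite eps_D ?scale0r.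
right=> c; apply/idP/idP => [/DI//|]; rewrite inI => /asboolP Ic.
(* A functional separating c from D would kill the module, hence vanish at c. *)
apply: contrapT => cD; have [f fD fc] := separating_functional subD cD.
suff /eqP : f c = 0 by rewrite fc oner_eq0.
apply: Ic => g; rewrite contl_comp; apply: contrapT => Nfg; apply: noN.
exists (f \o contl hC g) => // c' Dc'; apply: fD; exact: (stD _ _ _).1.
Qed.

End SimpleModule.
End ContractionCombination.

(** * Conilpotency *)

Section Conilpotency.
Variables (K : fieldType) (C : lmodType K) (hC : coalgebra C) (e : C).
Hypothesis comul_e : comul hC e = e ⊗ e.
Hypothesis counit_e : counit hC e = 1.
Implicit Types (f g : {linear C -> K^o}) (c : C).

(* The coradical filtration, shifted by one: [conil k] is the annihilator of the k-th
   power of the ideal of functionals vanishing at [e]. *)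
Fixpoint conil k c : Prop :=
  if k is k'.+1 then forall f, f e = 0 -> conil k' (contl hC f c) else c = 0.

Lemma conil_subspace k : subspace (conil k).
Proof.
elim: k => [|k IHk]; first by split=> // a _ _ -> ->; rewrite scaler0 addr0.
split=> [f _|a u v uk vk f f0]; first by rewrite linear0; apply: subspace0.
by rewrite linearP; apply: IHk.2; [apply: uk|apply: vk].
Qed.

Lemma conilS k c : conil k c -> conil k.+1 c.
Proof.
elim: k c => [|k IHk] c ck f f0; first by rewrite /= ck linear0.
by apply: IHk; apply: ck.
Qed.

Lemma conil_leq k l c : (k <= l)%N -> conil k c -> conil l c.
Proof.
move=> /subnKC <- ck.
by elim: (l - k)%N => [|n]; rewrite ?addn0 // addnS => /conilS.
Qed.

Lemma contl_split f c :
  contl hC f c = f e *: c + contl hC (f \- (f e \*: counit hC)) c.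
Proof.
rewrite -{2}(contl_counit hC c); apply: contl_combination => x /=.
by rewrite addrC subrK.
Qed.

Lemma contl_split0 f : (f \- (f e \*: counit hC)) e = 0.
Proof. by rewrite /= counit_e; apply/eqP; rewrite subr_eq0 [_ *: _]mulr1. Qed.

(** Write f as f(e) eps plus a functional vanishing at e: the first part acts by a scalar, the
    second lowers the degree. *)
Lemma conil_contl f k c : conil k c -> conil k (contl hC f c).
Proof.
case: k => [->|k ck]; first exact: linear0.
have subk := conil_subspace k.+1.
rewrite contl_split; apply: (subspaceD subk); first exact: (subspaceZ subk).
by apply: conilS; apply: ck; apply: contl_split0.
Qed.

Lemma conil_bounded n (w : 'I_n -> C) : (forall i, exists k, conil k (w i)) ->
  exists k, forall i, conil k (w i).
Proof.
move=> /choice[k wk]; exists (\max_i k i) => i.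
exact: (conil_leq (leq_bigmax i) (wk i)).
Qed.

Definition conilpotent c := exists k, conil k c.

Lemma conilpotent_subspace : subspace conilpotent.
Proof.
split=> [|a u v [k uk] [l vl]]; first by exists 0%N.
exists (maxn k l); apply: (conil_subspace _).2.
  exact: conil_leq (leq_maxl k l) uk.
exact: conil_leq (leq_maxr k l) vl.
Qed.

Lemma conilpotent_contl f c : conilpotent c -> conilpotent (contl hC f c).
Proof. by move=> [k ck]; exists k; apply: conil_contl. Qed.

(** The exponents for the various f have a common bound because the elements f . c with f(e) = 0
    have a finite spanning family among themselves. *)
Lemma conilpotent_step c :
  (forall f, f e = 0 -> conilpotent (contl hC f c)) -> conilpotent c.
Proof.
move=> cN; pose S d := exists2 f : {linear C -> K^o}, f e = 0 & d = contl hC f c.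
have subS : subspace S.
  split; first by exists \0; rewrite // /contl /tlift big1 // => p _; rewrite scale0r.
  move=> a _ _ [f f0 ->] [g g0 ->]; exists (a \*: f \+ g).
    by rewrite /= f0 g0 scaler0 addr0.
  by rewrite [RHS](@contl_combination _ _ _ a f g).
have [n [w cw]] := contl_orbit_spanned hC c.
have [|k [w' [Sw' Sspan _ _]]] := subspace_spanned (w := w) subS.
  by move=> _ [f _ ->].
have [|l w'l] := @conil_bounded _ w'.
  by move=> i; have [f f0 ->] := Sw' i; apply: cN.
exists l.+1 => f f0; apply: (spanned_least (conil_subspace l) w'l).
by apply: Sspan; exists f.
Qed.

(** Take d whose orbit is spanned by the least number n of vectors. A non-conilpotent f . d has a
    smaller orbit that still needs n vectors, so it contains d. *)
Lemma minimal_orbit c : ~ conilpotent c -> exists2 d, ~ conilpotent d &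
  forall f, ~ conilpotent (contl hC f d) -> exists g, contl hC g (contl hC f d) = d.
Proof.
move=> cN; pose P n := `[< exists (d : C) (w : 'I_n -> C),
  ~ conilpotent d /\ forall f, spanned w (contl hC f d) >].
have exP : exists n, P n.
  have [n [w cw]] := contl_orbit_spanned hC c.
  by exists n; apply/asboolP; exists c, w.
case: (ex_minnP exP) => n /asboolP[d [w [dN dw]]] minn.
exists d => // f fN; have subS := contl_orbit_subspace hC (contl hC f d).
have [|k [w' [Sw' Sspan kn nk]]] := subspace_spanned (w := w) subS.
  by move=> _ [g ->]; rewrite contl_comp; apply: dw.
have [||g gd] := nk _ d; last by exists g.
- apply/eqP; rewrite eqn_leq kn minn //; apply/asboolP.
  by exists (contl hC f d), w'; split=> // g; apply: Sspan; exists g.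
by rewrite -[d](contl_counit hC); apply: dw.
Qed.

Lemma line_stable : contraction_stable hC (fun c => exists a, c = a *: e).
Proof.
have eE : comul hC e = \sum_(i < 1) e ⊗ e by rewrite big_ord1.
move=> f _ [a ->]; rewrite !linearZ /= (contlE f eE) (contrE f eE) !big_ord1 /=.
by split; rewrite scalerA; eexists.
Qed.

(** Otherwise [minimal_orbit] gives a module simple modulo the conilpotent elements. Its coefficient
    coalgebra is simple, hence inside Ke, while a functional vanishing at e acts on the module as
    the identity; this forces the counit to vanish on the coefficients. *)
Lemma connected_conilpotent :
  (forall c, c \in coradical hC -> exists a, c = a *: e) -> forall c, conilpotent c.
Proof.
move=> coradK c; apply: contrapT => /minimal_orbit[d dN d_simple].
pose N := conilpotent; have subN : subspace N := conilpotent_subspace.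
have N_contl f c' : N c' -> N (contl hC f c') by apply: conilpotent_contl.
(* If every functional vanishing at e sent d to a conilpotent element, d itself would be
   conilpotent. *)
have [mN|] := pselect (forall f, f e = 0 -> conilpotent (contl hC f d)).
  by apply: dN; apply: conilpotent_step.
move=> /existsNP[f /not_implyP[fe fN]].
have [|g ge gN] := annihilator_unit subN N_contl d_simple line_stable _ fN.
  by move=> _ [a ->]; rewrite linearZ fe; apply: mulr0.
have [c' Ic' c'0] := coefficient_coalgebra_neq0 hC subN dN.
have [a c'E] : exists a, c' = a *: e.
  apply: coradK; apply/asboolP; exists [:: c']; rewrite big_seq1; split=> // c''.
  rewrite inE => /eqP->; exists (fun c => `[< coefficient_coalgebra hC N d c >]).
    exact: coefficient_coalgebra_simple.
  exact/asboolP.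
apply: c'0; have : (g \- counit hC) c' = 0.
  apply: Ic' => h; rewrite (@contl_combination _ _ _ (-1) (counit hC) g (g \- counit hC)).
    by rewrite scaleN1r contl_counit addrC.
  by move=> x; rewrite mulN1r addrC.
rewrite /= ge ?sub0r; last by exists a.
by move=> /eqP; rewrite oppr_eq0 => /eqP.
Qed.

End Conilpotency.

(** * Multiplication by a primitive element *)

HB.instance Definition _ (K : pzRingType) (V : lmodType K) (D : {linear V -> V}) n :=
  GRing.isLinear.Build K V V *:%R (iter n D)
    (nat_ind (fun n => linear (iter n D)) (fun _ _ _ => erefl _)
      (fun _ IHn a u v => etrans (congr1 D (IHn a u v)) (linearP D _ _ _)) n).

Section LeftMultiplication.
Variables (K : fieldType) (A : algType K) (x : A).

Definition lmul c : A := x * c.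

Lemma lmul_linear : linear lmul.
Proof. by move=> a u v; rewrite /lmul mulrDr scalerAr. Qed.

HB.instance Definition _ := GRing.isLinear.Build K A A *:%R lmul lmul_linear.

End LeftMultiplication.

Section PrimitiveElement.
Variables (K : fieldType) (E : algType K) (hE : hopf_algebra E).
Hypothesis charK : [pchar K] =i pred0.
Hypothesis connE : connected hE.
Variable x : E.
Hypothesis x_prim : primitive hE x.
Hypothesis x_neq0 : x <> 0.
Implicit Types (f g : {linear E -> K^o}) (c : E).

Notation conil := (conil hE 1).

Lemma hopf_comul1 : comul hE 1 = 1 ⊗ 1.
Proof. by case: (comul_monoid hE). Qed.

Lemma hopf_counit1 : counit hE 1 = 1.
Proof. by case: (counit_monoid hE). Qed.

Lemma hopf_comulM c d : comul hE (c * d) = comul hE c * comul hE d.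
Proof. by case: (comul_monoid hE). Qed.

Lemma hopf_counitM c d : counit hE (c * d) = counit hE c * counit hE d.
Proof. by case: (counit_monoid hE). Qed.

(** Applying eps ⊗ eps to the coproduct of x gives eps(x) = 2 eps(x). *)
Lemma counit_primitive : counit hE x = 0.
Proof.
have xE : comul hE x = \sum_(p <- [:: (x, 1); (1, x)]) p.1 ⊗ p.2.
  by rewrite big_cons big_seq1 x_prim.
have := counit_contl hE (counit hE) x.
rewrite (contlE _ xE) big_cons big_seq1 /= linearD !linearZ /= hopf_counit1.
by move=> /eqP; rewrite scale1r -subr_eq0 addrK scaler_eq0 oner_eq0 orbF => /eqP.
Qed.

(** The coproduct of xc is xc_1 ⊗ c_2 + c_1 ⊗ xc_2. *)
Lemma contl_mul_primitive f c :
  contl hE f (x * c) = x * contl hE f c + contl hE (f \o lmul x) c.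
Proof.
have [F FE] := tensor_lift (@scale_bilinl K E E f).
have contlF d : contl hE f d = F (comul hE d).
  by rewrite linear_tensor_sum; apply: eq_bigr => p _; rewrite FE.
rewrite contlF hopf_comulM x_prim {1}[comul hE c]tensorE mulr_sumr linear_sum.
rewrite /contl /tlift mulr_sumr -big_split; apply: eq_bigr => p _.
by rewrite mulrDl !tensM !mul1r linearD !FE /= scalerAr addrC.
Qed.

Lemma conil_mul_primitive k c : conil k c -> conil k.+1 (x * c).
Proof.
elim: k c => [|k IHk] c ck f f0; first by rewrite /= ck mulr0 linear0.
rewrite contl_mul_primitive; apply: (subspaceD (conil_subspace hE 1 k.+1)).
  by apply: IHk; apply: ck.
exact: (conil_contl hopf_counit1).
Qed.

Lemma conil_total c : exists k, conil k c.
Proof.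
apply: (connected_conilpotent hopf_comul1 hopf_counit1) => d.
by move=> /connE[a ->]; exists a.
Qed.

Lemma natK_neq0 n : n.+1%:R != 0 :> K.
Proof. by rewrite (pcharf0P K).1. Qed.

Section Injectivity.
Variable g : {linear E -> K^o}.
Hypothesis g1 : g 1 = 0.
Hypothesis gx : g x = 1.
Local Notation G := (contl hE g).

(** The commutator of G with multiplication by x is the action of [g \o lmul x], which takes the
    value g(x) = 1 at 1. Minus the counit, it vanishes at 1 and so lowers the degree. *)
Lemma contl_commutator i c :
  conil i.+1 c -> conil i (G (x * c) - x * G c - c).
Proof.
move=> ci; have : (((g \o lmul x) \- counit hE) : {linear E -> K^o}) 1 = 0.
  by rewrite /= /lmul mulr1 gx hopf_counit1 subrr.
move=> /ci; rewrite (@contl_combination _ _ _ (-1) (counit hE) (g \o lmul x)); last first.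
  by move=> d; rewrite mulN1r addrC.
by rewrite contl_counit scaleN1r contl_mul_primitive [x * _ + _]addrC addrK addrC.
Qed.

Lemma conil_iter i j c : conil (i + j) c -> conil i (iter j G c).
Proof.
elim: j i c => [|j IHj] i c; first by rewrite addn0.
by rewrite -addSnnS => /IHj; apply.
Qed.

(** The Weyl relation [G^(j+1), x] = (j+1) G^j up to terms of lower degree. In the induction, n is
    the error for j, lowered once more by G, and m is the error of one further commutation. *)
Lemma iter_contl_commutator i j c : conil (i + j).+1 c ->
  conil i (iter j.+1 G (x * c) - x * iter j.+1 G c - j.+1%:R *: iter j G c).
Proof.
elim: j i => [|j IHj] i ci; first by
  rewrite scale1r; apply: contl_commutator; rewrite addn0 in ci.
have /IHj n_in : conil (i.+1 + j).+1 c by rewrite addSnnS.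
set n := (X in conil _ X) in n_in.
have -> : iter j.+2 G (x * c) = G (n + x * iter j.+1 G c + j.+1%:R *: iter j G c).
  by rewrite /n addrAC subrK subrK.
rewrite linearD linearD linearZ /= -![G (iter _ G c)]/(iter _.+1 G c).
have /contl_commutator m_in : conil i.+1 (iter j.+1 G c).
  by apply: conil_iter; rewrite addSn.
set m := (X in conil _ X) in m_in.
have -> : G (x * iter j.+1 G c) = m + x * iter j.+2 G c + iter j.+1 G c.
  by rewrite /m addrAC subrK subrK.
rewrite -[j.+2%:R]natr1 scalerDl scale1r.
have -> : forall a b u v w : E, a + (b + u + v) + w - u - (w + v) = a + b.
  move=> a b u v w; rewrite (addrC w v) opprD addrA -[b + u + v]addrA.
  rewrite [u + v]addrC !addrA -addrA -opprD [_ + w - u]addrAC addrK.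
  by rewrite -[a + b + v + w]addrA addrK.
apply: (subspaceD (conil_subspace hE 1 i)) m_in; exact: n_in.
Qed.

(** Descending induction on j shows that G^j c lies in degree k - j. As xc = 0, the Weyl relation
    expresses (j+1) G^j c through x G^(j+1) c and terms of lower degree, and j+1 is invertible. *)
Lemma conil_mul_primitive_cancel k c : x * c = 0 -> conil k.+1 c -> conil k c.
Proof.
move=> xc ck; suff H t j : (j + t = k.+1)%N -> conil (k - j) (iter j G c).
  by have := H k.+1 0%N erefl; rewrite subn0.
elim: t j => [|t IHt] j; first by
  rewrite addn0 => ->; rewrite (eqP (leqnSn k)); move: ck => /(@conil_iter 0).
rewrite addnS => -[jtk]; have jk : (j <= k)%N by rewrite -jtk leq_addr.
have Gj : conil (k - j) (x * iter j.+1 G c).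
  have := IHt j.+1; rewrite addSn jtk => /(_ erefl).
  (* At j = k the subtraction k - (k+1) is truncated to 0, but degree 0 already means G^(k+1) c =
     0. *)
  move: jk; rewrite leq_eqVlt => /predU1P[->|jk]; last first.
    by move=> /conil_mul_primitive; rewrite -subSn.
  by rewrite subnn (eqP (leqnSn k)) => h; have -> : iter k.+1 G c = 0; [|rewrite mulr0].
have := @iter_contl_commutator (k - j) j c; rewrite subnK // xc linear0 sub0r.
move=> /(_ ck) h; have subk := conil_subspace hE 1 (k - j).
have {h} := subspaceN subk (subspaceD subk h Gj).
rewrite addrAC addNr sub0r opprK => /(subspaceZ subk (j.+1%:R^-1)).
by rewrite scalerA mulVf ?natK_neq0 // scale1r.
Qed.

Lemma mul_primitive_cancel c : x * c = 0 -> c = 0.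
Proof.
move=> xc; have [k] := conil_total c; elim: k => [//|k IHk].
by move=> /(conil_mul_primitive_cancel xc).
Qed.

End Injectivity.

(** As eps(x) = 0 and x is nonzero, x is not in K1, so a functional g with g(1) = 0 and g(x) = 1
    exists. *)
Lemma lreg_primitive : GRing.lreg x.
Proof.
pose S u := exists a : K, u = a *: 1 :> E.
have subS : subspace S.
  split=> [|a _ _ [b ->] [d ->]]; first by exists 0; rewrite scale0r.
  by exists (a * b + d); rewrite scalerDl scalerA.
have x_notK : ~ S x.
  move=> [a xE]; apply: x_neq0; rewrite xE; have := counit_primitive.
  rewrite xE linearZ hopf_counit1 => /eqP.
  by rewrite scaler_eq0 oner_eq0 orbF => /eqP->; rewrite scale0r.
have [g gK gx] := separating_functional subS x_notK.
have g1 : g 1 = 0 by apply: gK; exists 1; rewrite scale1r.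
move=> u v uv; apply/eqP; rewrite -subr_eq0; apply/eqP.
by apply: (mul_primitive_cancel g1 gx); rewrite mulrBr uv subrr.
Qed.

(** Let f be 1 at x and 0 on S = K1 + x ker(eps), and use xc = eps(c) x + x(c - eps(c)1). If x were
    in S, then x = xc with eps(c) = 0, and cancelling x would give c = 1. *)
Lemma primitive_dual : exists2 f : {linear E -> K^o},
  f 1 = 0 & forall c, f (x * c) = counit hE c.
Proof.
have K1 (a : K) : a *: (1 : K^o) = a by apply: mulr1.
pose S u := exists a c, counit hE c = 0 /\ u = a *: 1 + x * c.
have subS : subspace S.
  split=> [|k _ _ [a [c [c0 ->]]] [b [d [d0 ->]]]].
    by exists 0, 0; rewrite linear0 scale0r mulr0 addr0.
  exists (k * a + b), (k *: c + d); split; first by rewrite linearP c0 d0 scaler0 addr0.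
  by rewrite scalerDr mulrDr scalerDl scalerA scalerAr addrACA.
have Sx : ~ S x.
  move=> [a [c [c0 xE]]]; have a0 : a = 0.
    have := counit_primitive; rewrite {1}xE linearD linearZ /= hopf_counit1.
    rewrite hopf_counitM c0 mulr0 addr0 => /eqP.
    by rewrite scaler_eq0 oner_eq0 orbF => /eqP.
  have : x * c = x * 1 by rewrite mulr1 {2}xE a0 scale0r add0r.
  move=> /lreg_primitive c1; have := hopf_counit1; rewrite -c1 c0 => /eqP.
  by rewrite eq_sym oner_eq0.
have [f fS fx] := separating_functional subS Sx.
exists f => [|c]; first by apply: fS; exists 1, 0; rewrite linear0 scale1r mulr0 addr0.
have -> : x * c = counit hE c *: x + x * (c - counit hE c *: 1).
  by rewrite mulrBr -scalerAr mulr1 addrC subrK.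
rewrite linearD linearZ fx /= [f (x * _)]fS ?addr0 ?K1 //.
exists 0, (c - counit hE c *: 1); rewrite scale0r add0r; split=> //.
by rewrite linearB linearZ /= hopf_counit1 K1 subrr.
Qed.

Section Derivation.
Variable f : {linear E -> K^o}.
Hypothesis f1 : f 1 = 0.
Hypothesis fx : forall c, f (x * c) = counit hE c.

Lemma contl_primitive_dual c : contl hE f (x * c) = x * contl hE f c + c.
Proof.
rewrite contl_mul_primitive -{4}(contl_counit hE c); congr (_ + _).
by apply: eq_bigr => p _; rewrite /= [f _]fx.
Qed.

Lemma contl_primitive_dual_nil c : exists n, iter n (contl hE f) c = 0.
Proof. by have [k ck] := conil_total c; exists k; apply: (@conil_iter f f1 0 k c ck). Qed.

Lemma contl_primitive_dual1 : contl hE f 1 = 0.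
Proof.
have E1 : comul hE 1 = \sum_(i < 1) 1 ⊗ 1 by rewrite big_ord1 hopf_comul1.
by rewrite (contlE f E1) big_ord1 f1 scale0r.
Qed.

(** The n-th iterate is the action of a convolution power q of f, and eps(q . c) = q(c). *)
Lemma contl_counit_iter n c :
  contl hE (counit hE \o iter n (contl hE f)) c = iter n (contl hE f) c.
Proof.
have [q qE] : exists q : {linear E -> K^o}, forall c, contl hE q c = iter n (contl hE f) c.
  elim: n => [|n [q IHq]]; first by exists (counit hE) => d; rewrite contl_counit.
  by exists (f \o contl hE q) => d; rewrite -contl_comp IHq.
rewrite -qE; apply: eq_bigr => p _; congr (_ *: _).
by rewrite -[RHS](counit_contl hE) qE.
Qed.

End Derivation.
End PrimitiveElement.

(** * Divided powers *)

(** The square sum is supported on the triangle i + j < M, which is summed along antidiagonals. *)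
Lemma sum_triangle (V : nmodType) (F : nat -> nat -> V) M :
    (forall i j, (M <= i + j)%N -> F i j = 0) ->
  \sum_(i < M) \sum_(j < M) F i j = \sum_(s < M) \sum_(i < s.+1) F (s - i)%N i.
Proof.
move=> F0; have H N : \sum_(s < N) \sum_(i < s.+1) F (s - i)%N i =
    \sum_(j < N) \sum_(i < N - j) F i j.
  elim: N => [|N IHN]; first by rewrite !big_ord0.
  rewrite big_ord_recr {}IHN /=.
  rewrite -[in LHS](@big_mkord _ _ _ N.+1 xpredT (fun i => F (N - i)%N i)).
  rewrite big_nat_recr //= big_mkord subnn addrA -big_split [RHS]big_ord_recr /=.
  rewrite subSn // subnn big_ord_recr big_ord0 /= add0r; congr (_ + _).
  by apply: eq_bigr => j _; rewrite subSn 1?ltnW // big_ord_recr.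
rewrite H exchange_big /=; apply: eq_bigr => j _.
rewrite -!(big_mkord xpredT (fun i => F i j)) (@big_cat_nat _ _ _ (M - j)) ?leq_subr //=.
rewrite [X in _ + X]big_nat_cond [X in _ + X]big1 ?addr0 // => i /andP[/andP[ij _] _].
by apply: F0; rewrite addnC -leq_subLR.
Qed.

(** The value does not depend on the truncation bound, so linearity may be checked at a bound common
    to both arguments. *)
Lemma locally_finite_sum (K : pzRingType) (V W : lmodType K) (T : nat -> {linear V -> W}) :
    (forall v, exists n, forall m, (n <= m)%N -> T m v = 0) ->
  exists L : {linear V -> W}, forall v n,
    (forall m, (n <= m)%N -> T m v = 0) -> L v = \sum_(m < n) T m v.
Proof.
move=> /choice[N NP]; pose L v := \sum_(m < N v) T m v.
have LE v n : (forall m, (n <= m)%N -> T m v = 0) -> L v = \sum_(m < n) T m v.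
  have H k l : (k <= l)%N -> (forall m, (k <= m)%N -> T m v = 0) ->
      \sum_(m < k) T m v = \sum_(m < l) T m v.
    move=> kl T0; rewrite -!(big_mkord xpredT (fun m => T m v)).
    rewrite [RHS](@big_cat_nat _ _ _ k) //= [X in _ + X]big_nat_cond.
    by rewrite [X in _ + X]big1 ?addr0 // => m /andP[/andP[km _] _]; apply: T0.
  move=> T0; rewrite (H n (maxn n (N v))) ?leq_maxl // /L.
  by rewrite (H (N v) (maxn n (N v))) ?leq_maxr //; apply: NP.
have L_lin : linear L.
  move=> a u v; pose n := maxn (N u) (N v).
  have Tu m : (n <= m)%N -> T m u = 0 by rewrite geq_max => /andP[/NP].
  have Tv m : (n <= m)%N -> T m v = 0 by rewrite geq_max => /andP[_ /NP].
  rewrite (LE u n) // (LE v n) // (LE _ n) => [|m mn].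
    by rewrite scaler_sumr -big_split; apply: eq_bigr => m _; rewrite linearP.
  by rewrite linearP Tu // Tv // scaler0 addr0.
pose L' : {linear V -> W} := HB.pack L (GRing.isLinear.Build _ _ _ _ L L_lin).
by exists L'.
Qed.

(** With divided powers, the binomial formula, the coproduct of a primitive element's powers and the
    action of D carry no numerical coefficients. *)
HB.lock Definition dpow (K : fieldType) (A : algType K) (a : A) n : A :=
  (n`!%:R)^-1 *: a ^+ n.

Section DividedPowers.
Variables (K : fieldType) (A : algType K).
Hypothesis charK : [pchar K] =i pred0.
Implicit Types a b : A.

Lemma dpow_def a n : dpow a n = (n`!%:R)^-1 *: a ^+ n.
Proof. by rewrite dpow.unlock. Qed.

Lemma factK_neq0 n : n`!%:R != 0 :> K.
Proof. by rewrite (pcharf0P K).1 // -lt0n fact_gt0. Qed.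

Lemma dpow0 a : dpow a 0 = 1.
Proof. by rewrite !dpow_def fact0 invr1 scale1r. Qed.

Lemma dpow1 a : dpow a 1 = a.
Proof. by rewrite !dpow_def invr1 scale1r. Qed.

Lemma dpowE a n : a ^+ n = n`!%:R *: dpow a n.
Proof. by rewrite dpow_def scalerA mulfV ?factK_neq0 // scale1r. Qed.

Lemma dpowS a n : a * dpow a n = n.+1%:R *: dpow a n.+1.
Proof.
rewrite !dpow_def factS natrM invfM scalerA mulrA mulfV ?mul1r; last first.
  exact: natK_neq0 charK n.
by rewrite -scalerAr exprS.
Qed.

Lemma dpow0S n : dpow (0 : A) n = (n == 0)%:R.
Proof.
rewrite dpow_def expr0n; case: n => [|n]; rewrite /= ?scaler0 //.
by rewrite fact0 invr1 scale1r.
Qed.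

Lemma dpowD a b n : GRing.comm a b ->
  dpow (a + b) n = \sum_(i < n.+1) dpow a (n - i) * dpow b i.
Proof.
move=> cab; rewrite dpow_def exprDn_comm // scaler_sumr; apply: eq_bigr => i _.
rewrite !dpow_def; have le_in : (i <= n)%N by rewrite -ltnS.
rewrite -scalerAl -scalerAr scalerA -scaler_nat scalerA; congr (_ *: _).
rewrite -(bin_fact le_in) !natrM !invfM mulrAC mulVf ?mul1r 1?mulrC //.
by rewrite (pcharf0P K).1 // -lt0n bin_gt0.
Qed.

End DividedPowers.

(** * Modules over the Weyl algebra *)

HB.instance Definition _ (R : nzRingType) (V : lmodType R) (S : submodClosed V) :=
  GRing.isLinear.Build R V (lmod_quot S) *:%R \pi_(lmod_quot S)%qT
    (fun a u v => etrans (lmod_quotD S (a *: u) v)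
      (congr1 (fun w => w + _) (lmod_quotZ S a u))).

Section Polyalg.
Variables (K : fieldType) (E : algType K) (x : E).

Lemma gen_subalg_gen : x \in gen_subalg x.
Proof. by apply/gen_subalgP. Qed.

Definition polyalg_gen : polyalg x := Sub x gen_subalg_gen.

Lemma polyalg_inclX n : polyalg_incl (polyalg_gen ^+ n) = x ^+ n.
Proof. by rewrite rmorphXn. Qed.

(** The values p(x) of polynomials form a subalgebra containing x, so they exhaust K[x]. *)
Lemma polyalg_ind (S : polyalg x -> Prop) :
  subspace S -> (forall n, S (polyalg_gen ^+ n)) -> forall h, S h.
Proof.
move=> subS SX h; pose T : {pred E} := fun y => `[< exists p, y = horner_alg x p >].
have inT y : (y \in T) = `[< exists p, y = horner_alg x p >] by [].
have /gen_subalgP/(_ T) : polyalg_incl h \in gen_subalg x by apply: valP.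
rewrite inT => /(_ _ _)/asboolP[||p hp].
- split=> [|a u v|u v]; rewrite ?inT.
  + by apply/asboolP; exists 1; rewrite rmorph1.
  + move=> /asboolP[p ->] /asboolP[q ->]; apply/asboolP; exists (a *: p + q).
    by rewrite [RHS]linearP /= mulr_algl.
  by move=> /asboolP[p ->] /asboolP[q ->]; apply/asboolP; exists (p * q); rewrite [RHS]rmorphM.
- by apply/asboolP; exists 'X; rewrite horner_algX.
suff -> : h = \sum_(i < size p) p`_i *: polyalg_gen ^+ i.
  by apply: subspace_sum => // i _; apply: subspaceZ.
apply: val_inj; rewrite -[LHS]/(polyalg_incl h) -[RHS]/(polyalg_incl _) hp.
rewrite linear_sum -[p in LHS]coefK poly_def linear_sum; apply: eq_bigr => i _.
by rewrite !linearZ /= rmorphXn /= horner_algX polyalg_inclX mulr_algl.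
Qed.

End Polyalg.

HB.instance Definition _ (R : comNzRingType) (V W : lmodType R) (v : V) :=
  GRing.isLinear.Build R W (V ⊗ W)%type *:%R (tens v)
    (fun a w w' => etrans (tensDr v (a *: w) w')
      (congr1 (fun t => t + _) (tensZr a v w))).

Section WeylModule.
Variables (K : fieldType) (E : algType K) (x : E) (D : {linear E -> E}).
Hypothesis charK : [pchar K] =i pred0.
Hypothesis D_mulx : forall c, D (x * c) = x * D c + c.
Hypothesis D_nil : forall c, exists n, iter n D c = 0.
Implicit Types c : E.

Lemma iter_leq0 m n c : (m <= n)%N -> iter m D c = 0 -> iter n D c = 0.
Proof. by move=> /subnK <- c0; rewrite iterD c0 linear0. Qed.

Lemma D_nil_leq c : exists n, forall m, (n <= m)%N -> iter m D c = 0.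
Proof. by have [n c0] := D_nil c; exists n => m /iter_leq0; apply. Qed.

Lemma iter_mulx n c : iter n.+1 D (x * c) = x * iter n.+1 D c + n.+1%:R *: iter n D c.
Proof.
elim: n => [|n IHn]; first by rewrite /= D_mulx scale1r.
rewrite iterS IHn linearD linearZ D_mulx /= -addrA; congr (_ + _).
by rewrite -[n.+2%:R]natr1 scalerDl scale1r addrC.
Qed.

(** D differentiates divided powers with respect to x. The scalar a treats x and -x at once, and the
    induction cancels n+2 in characteristic 0. *)
Lemma D_dpow a n c :
  D (dpow (a *: x) n.+1 * c) = dpow (a *: x) n.+1 * D c + a *: (dpow (a *: x) n * c).
Proof.
have scaled m y : m.+1%:R *: (dpow (a *: x) m.+1 * y) = a *: (x * (dpow (a *: x) m * y)).
  by rewrite scalerAl -dpowS // -mulrA -scalerAl.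
have eqD m u v : m.+1%:R *: u = m.+1%:R *: v :> E -> u = v.
  move=> /(congr1 (fun w => m.+1%:R^-1 *: w)).
  by rewrite !scalerA mulVf ?natK_neq0 // !scale1r.
elim: n => [|n IHn]; first by rewrite dpow0 dpow1 mul1r -!scalerAl linearZ D_mulx /= scalerDr.
apply: (eqD n.+1).
transitivity (D (n.+2%:R *: (dpow (a *: x) n.+2 * c))); first by rewrite linearZ.
rewrite scaled linearZ /= D_mulx IHn.
rewrite !scalerDr mulrDr scaled scalerDr -addrA; congr (_ + _).
rewrite -scalerAr -scaled scalerA [a * _]mulrC -scalerA -[n.+2%:R]natr1.
by rewrite scalerDl scale1r !scalerA mulrC.
Qed.

Lemma D_dpow1 n c : D (dpow x n.+1 * c) = dpow x n.+1 * D c + dpow x n * c.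
Proof. by have := D_dpow 1 n c; rewrite !scale1r. Qed.

Lemma D_dpowN1 n c : D (dpow (- x) n.+1 * c) = dpow (- x) n.+1 * D c - dpow (- x) n * c.
Proof. by have := D_dpow (-1) n c; rewrite !scaleN1r. Qed.

Section Projection.
Variable tau : {linear E -> E}.
Hypothesis tauE : forall c n, (forall m, (n <= m)%N -> iter m D c = 0) ->
  tau c = \sum_(m < n) dpow (- x) m * iter m D c.

(** Here tau is the projection of E onto ker D along xE; applying D to its defining sum
    telescopes. *)
Lemma D_tau c : D (tau c) = 0.
Proof.
have [n nc] := D_nil_leq c.
have H k : D (\sum_(m < k.+1) dpow (- x) m * iter m D c) = dpow (- x) k * iter k.+1 D c.
  elim: k => [|k IHk]; first by rewrite big_ord1 /= dpow0 !mul1r.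
  by rewrite big_ord_recr linearD IHk D_dpowN1 addrC subrK.
by rewrite (tauE (n := n.+1)) ?H ?nc ?mulr0 // => m /ltnW/nc.
Qed.

Lemma tau_mulx c : tau (x * c) = 0.
Proof.
have [n nc] := D_nil_leq c.
have H k : \sum_(m < k.+1) dpow (- x) m * iter m D (x * c)
    = dpow (- x) k * (x * iter k D c).
  elim: k => [|k IHk]; first by rewrite big_ord1.
  rewrite big_ord_recr {}IHk /= -iterS iter_mulx mulrDr addrCA -[RHS]addr0; congr (_ + _).
  rewrite -scalerAr scalerAl -dpowS // mulNr mulNr.
  have cx : x * dpow (- x) k = dpow (- x) k * x.
    by rewrite !dpow_def -scalerAr -scalerAl; congr (_ *: _); apply: commrX; apply: commrN.
  by rewrite mulrA cx subrr.
rewrite (tauE (n := n.+1)) ?H ?nc ?mulr0 // => -[//|m] nm.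
by rewrite iter_mulx !nc ?mulr0 ?scaler0 ?addr0 // ltnW.
Qed.

(** All terms of tau c other than the zeroth one, which is c, have a left factor x. *)
Lemma tau_mod c : tau c - c \in right_ideal x.
Proof.
have [n nc] := D_nil_leq c; rewrite (tauE (n := n.+1)) => [|m /ltnW/nc//].
rewrite big_ord_recl /= dpow0 mul1r addrC addKr.
suff : subspace (fun y => y \in right_ideal x).
  move=> subI; apply: (subspace_sum subI) => i _; apply/right_idealP.
  exists (- (i.+1%:R^-1 *: (dpow (- x) i * iter i.+1 D c))).
  have -> : dpow (- x) (lift ord0 i) = i.+1%:R^-1 *: (- x * dpow (- x) i).
    by rewrite dpowS // scalerA mulVf ?natK_neq0 // scale1r.
  move: (dpow (- x) i) => d.
  by rewrite -scalerAl !mulNr scalerN mulrN -scalerAr mulrA.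
exact: right_ideal_closed.
Qed.

(** A Taylor expansion: grouping by s = i + j, the inner sum is the divided power of x + (-x) = 0,
    so only s = 0 survives. *)
Lemma tau_sum c n : (forall m, (n <= m)%N -> iter m D c = 0) ->
  \sum_(m < n) dpow x m * tau (iter m D c) = c.
Proof.
case: n => [/(_ 0%N erefl) /= ->|n nc]; first by rewrite big_ord0.
transitivity (\sum_(i < n.+1) \sum_(j < n.+1) dpow x i * (dpow (- x) j * iter (i + j) D c)).
  apply: eq_bigr => i _; rewrite -mulr_sumr (tauE (n := n.+1)).
    by congr (_ * _); apply: eq_bigr => j _; rewrite -iterD addnC.
  by move=> m nm; rewrite -iterD; apply: nc; apply: leq_trans nm (leq_addr _ _).
rewrite (@sum_triangle _ (fun i j => dpow x i * (dpow (- x) j * iter (i + j) D c)))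
  => [|i j /nc ->]; last by rewrite !mulr0.
transitivity (\sum_(s < n.+1) dpow 0 s * iter s D c).
  apply: eq_bigr => s _; rewrite -[X in dpow X s](subrr x) dpowD //; last first.
    exact: commrN.
  by rewrite mulr_suml; apply: eq_bigr => i _; rewrite mulrA subnK // -ltnS.
rewrite big_ord_recl dpow0 mul1r big1 ?addr0 // => i _.
by rewrite dpow0S mul0r.
Qed.

Lemma iter_dpow_ker n m k : D k = 0 ->
  iter n D (dpow x (m + n) * k) = dpow x m * k.
Proof.
move=> Dk; elim: n => [|n IHn]; first by rewrite addn0.
by rewrite iterSr addnS D_dpow1 Dk mulr0 add0r.
Qed.

End Projection.

(** The inverse of phi sends h ⊗ [c] to h tau(c), which is well defined as tau kills xE. One
    composite is the identity by [tau_sum], the other is checked on powers of x. *)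
Lemma weyl_splitting :
  exists f : {linear E -> (polyalg x ⊗ lmod_quot (right_ideal x))%type}, bijective f.
Proof.
pose X := polyalg_gen x; pose Q := lmod_quot (right_ideal x).
have nilT (W : lmodType K) (F : nat -> {linear E -> W}) c :
    exists n, forall m, (n <= m)%N -> (F m \o iter m D) c = 0.
  by have [n nc] := D_nil_leq c; exists n => m nm /=; rewrite nc ?linear0.
have [tau tauP] := locally_finite_sum (nilT _ (fun n => lmul (dpow (- x) n))).
have [phi phiP] := locally_finite_sum (nilT _ (fun n => tens (dpow X n) \o \pi_Q%qT)).
have tauE c n : (forall m, (n <= m)%N -> iter m D c = 0) ->
    tau c = \sum_(m < n) dpow (- x) m * iter m D c.
  by move=> nc; apply: tauP => m nm /=; rewrite nc ?linear0.
have phiE c n : (forall m, (n <= m)%N -> iter m D c = 0) ->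
    phi c = \sum_(m < n) dpow X m ⊗ \pi_Q%qT (iter m D c).
  by move=> nc; apply: phiP => m nm /=; rewrite nc // !linear0.
have piQ c d : c - d \in right_ideal x -> \pi_Q%qT c = \pi_Q%qT d.
  by move=> cd; apply/lmod_quot_eqP.
have tau_pi c : tau (repr (\pi_Q%qT c)) = tau c.
  have /lmod_quot_eqP/right_idealP[d cd] : \pi_Q%qT (repr (\pi_Q%qT c)) = \pi_Q%qT c.
    exact: reprK.
  by apply/eqP; rewrite -subr_eq0 -linearB cd (tau_mulx tauE).
have [psi psiE] : exists psi : {linear (polyalg x ⊗ Q)%type -> E},
    forall h c, psi (h ⊗ \pi_Q%qT c) = polyalg_incl h * tau c.
  have [|psi psiE] := @tensor_lift K (polyalg x) Q E
      (fun h q => polyalg_incl h * tau (repr q)).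
    split=> [q|h] a u v /=; first by rewrite linearP mulrDl scalerAl.
    rewrite -[u]reprK -[v]reprK -linearP !tau_pi linearP mulrDr scalerAr //.
  by exists psi => h c; rewrite psiE tau_pi.
have incl_dpow n : polyalg_incl (dpow X n) = dpow x n.
  by rewrite !dpow_def linearZ /= polyalg_inclX.
(* D^m lowers the divided power to n - m: the result is 0 for m > n, lies in xE for m < n, and is
   tau c, congruent to c, for m = n. *)
have phi_dpow n c : phi (dpow x n * tau c) = dpow X n ⊗ \pi_Q%qT c.
  have Dk := D_tau tauE c; have iterK m := iter_dpow_ker _ m Dk.
  rewrite (phiE _ n.+1) => [|m nm]; last first.
    by rewrite -(subnK nm) iterD /= -[in iter n D _](add0n n) iterK dpow0 mul1r Dk linear0.
  rewrite big_ord_recr /= big1 ?add0r => [|[m /= mn] _].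
    rewrite -[in iter n D _](add0n n) iterK dpow0 mul1r; congr (_ ⊗ _).
    exact/piQ/(tau_mod tauE).
  have -> : n = ((n - m.+1).+1 + m)%N by rewrite addSnnS subnK.
  rewrite iterK (_ : \pi_Q%qT _ = 0) ?linear0 // -(linear0 \pi_Q%qT).
  apply: piQ; rewrite subr0; apply/right_idealP.
  move: (n - m.+1)%N => l; exists (l.+1%:R^-1 *: (dpow x l * tau c)).
  rewrite -scalerAr mulrA dpowS //; move: (dpow x l.+1) => d.
  by rewrite -scalerAl scalerA mulVf ?natK_neq0 // scale1r.
exists phi; exists psi => [c|].
  have [n nc] := D_nil_leq c.
  rewrite (phiE _ n nc) linear_sum -[RHS](tau_sum tauE nc).
  by apply: eq_bigr => i _; rewrite psiE incl_dpow.
apply: (tensor_ext (f := phi \o psi) (g := idfun)) => [||h]; [exact: linearP|by []|].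
elim/quotW=> c /=; rewrite psiE; elim/polyalg_ind: h => [|n].
  split=> [|a u v hu hv]; first by rewrite linear0 mul0r linear0 tens0l.
  by rewrite linearP mulrDl -scalerAl linearP hu hv tensDl tensZl.
by rewrite polyalg_inclX dpowE // -scalerAl linearZ phi_dpow /= -tensZl -dpowE.
Qed.

End WeylModule.

(** * The weak projection *)

Section TensorAlgType.
Variables (R : fieldType) (A B : algType R).

(** The tensor product of functionals with value 1 at 1 takes the value 1 at 1 ⊗ 1. The [algType]
    structure built on this lets divided powers be formed in the tensor square. *)
Lemma tensor_oner_neq0 : (1 : (A ⊗ B)%type) != 0.
Proof.
have sub0 (V : lmodType R) : subspace (fun v : V => v = 0).
  by split=> // a _ _ -> ->; rewrite scaler0 addr0.
have [|f _ f1] := @separating_functional R A _ 1 (sub0 A); first exact/eqP/oner_neq0.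
have [|g _ g1] := @separating_functional R B _ 1 (sub0 B); first exact/eqP/oner_neq0.
have [F FE] := tensor_lift (@scale_bilinl R A R^o f).
apply/eqP => t0; have := FE 1 (g 1); have -> : (1 : A) ⊗ g 1 = tmap idfun g (1 ⊗ 1).
  by rewrite tmapE.
rewrite -[1 ⊗ 1]/(1 : (A ⊗ B)%type) t0 !linear0 f1 g1 scale1r => /eqP.
by rewrite eq_sym oner_eq0.
Qed.

HB.instance Definition _ :=
  GRing.PzSemiRing_isNonZero.Build (A ⊗ B)%type tensor_oner_neq0.

Lemma tensor_scalerAl (a : R) (s t : (A ⊗ B)%type) : a *: (s * t) = a *: s * t.
Proof.
have h := (tmul_bilinear A B).1 t a s 0.
have t0 : @tmul R A B 0 t = 0 by rewrite -[LHS]/(0 * t) mul0r.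
by move: h; rewrite /= !addr0 t0 addr0 => /esym.
Qed.

Lemma tensor_scalerAr (a : R) (s t : (A ⊗ B)%type) : a *: (s * t) = s * (a *: t).
Proof.
have h := (tmul_bilinear A B).2 s a t 0.
have t0 : @tmul R A B s 0 = 0 by rewrite -[LHS]/(s * 0) mulr0.
by move: h; rewrite /= !addr0 t0 addr0 => /esym.
Qed.

HB.instance Definition _ :=
  GRing.Lmodule_isLalgebra.Build R (A ⊗ B)%type tensor_scalerAl.
HB.instance Definition _ :=
  GRing.Lalgebra_isAlgebra.Build R (A ⊗ B)%type tensor_scalerAr.

Lemma tensXl (a : A) n : (a ⊗ (1 : B)) ^+ n = a ^+ n ⊗ 1.
Proof. by elim: n => [|n IHn]; rewrite ?expr0 // !exprS IHn tensM mulr1. Qed.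

Lemma tensXr (b : B) n : ((1 : A) ⊗ b) ^+ n = 1 ⊗ b ^+ n.
Proof. by elim: n => [|n IHn]; rewrite ?expr0 // !exprS IHn tensM mulr1. Qed.

End TensorAlgType.

Lemma tmap_mul (R : comNzRingType) (A A' B B' : algType R)
    (f : {lrmorphism A -> A'}) (g : {lrmorphism B -> B'}) s t :
  tmap f g (s * t) = tmap f g s * tmap f g t.
Proof.
rewrite [s]tensorE [t]tensorE !tmap_sum !mulr_suml linear_sum; apply: eq_bigr => p _.
rewrite !mulr_sumr linear_sum; apply: eq_bigr => q _.
by rewrite tensM /= tmapE !rmorphM tensM.
Qed.

Lemma tassoc_tmap (R : comNzRingType) (V V' W W' U U' : lmodType R)
    (f : {linear V -> V'}) (g : {linear W -> W'}) (h : {linear U -> U'}) t :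
  tassoc (tmap (tmap f g) h t) = tmap f (tmap g h) (tassoc t).
Proof.
have E : (tassoc \o tmap (tmap f g) h) t = (tmap f (tmap g h) \o tassoc) t.
  rewrite !linear_tensor_sum; apply: eq_bigr => -[x u] _; rewrite [x]tensorE tens_suml.
  rewrite (linear_sum (tassoc \o tmap (tmap f g) h)).
  rewrite (linear_sum (tmap f (tmap g h) \o tassoc)).
  by apply: eq_bigr => q _; rewrite /= tmapE /= tmapE !tassocE tmapE /= tmapE.
exact: E.
Qed.

Lemma tlift_tmap (R : comNzRingType) (V V' W W' U U' : lmodType R)
    (f : {linear V -> V'}) (g : {linear W -> W'}) (u : {linear U -> U'})
    (b : V -> W -> U) (b' : V' -> W' -> U') t :
    bilinear_for *:%R *:%R b' -> (forall v w, u (b v w) = b' (f v) (g w)) ->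
  u (tlift b t) = tlift b' (tmap f g t).
Proof.
move=> b'_bilin ubE; rewrite {2}[t]tensorE tmap_sum tlift_sum // /tlift linear_sum.
by apply: eq_bigr => p _; rewrite ubE.
Qed.

(** The retraction p makes i and its tensor powers injective, so the laws can be checked in C. *)
Lemma retract_coalgebra (K : fieldType) (C H : lmodType K) (hC : coalgebra C)
    (i : {linear H -> C}) (p : {linear C -> H}) (d : {linear H -> (H ⊗ H)%type}) :
    cancel i p -> (forall h, tmap i i (d h) = comul hC (i h)) ->
  exists hH : coalgebra H, (forall h, comul hH h = d h) /\
    forall h, counit hH h = counit hC (i h).
Proof.
move=> iK dE; have inj_i := can_inj iK.
have dA h : tassoc (tmap d idfun (d h)) = tmap idfun d (d h).
  apply: (can_inj (tmap_cancel iK (tmap_cancel iK iK))).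
  rewrite -tassoc_tmap !tmap_comp.
  have -> : tmap (tmap i i \o d) (i \o idfun) (d h) = tmap (comul hC \o i) (idfun \o i) (d h).
    by congr (tmap _ _ (d h)); apply/funext => u /=.
  have -> : tmap (i \o idfun) (tmap i i \o d) (d h) = tmap (idfun \o i) (comul hC \o i) (d h).
    by congr (tmap _ _ (d h)); apply/funext => u /=.
  by rewrite -!tmap_comp dE comulA.
have dl h : tlift (fun a b => (counit hC \o i) a *: b) (d h) = h.
  apply: inj_i; rewrite -[RHS](counitl hC) -dE; apply: tlift_tmap => [|v w].
    exact: scale_bilinl.
  by rewrite linearZ.
have dr h : tlift (fun a b => (counit hC \o i) b *: a) (d h) = h.
  apply: inj_i; rewrite -[RHS](counitr hC) -dE; apply: tlift_tmap => [|v w].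
    exact: scale_bilinr.
  by rewrite linearZ.
by exists (Coalgebra dA dl dr).
Qed.

Definition scale_by (R : pzRingType) (V : lmodType R) (v : V) (a : R^o) : V := (a : R) *: v.

HB.instance Definition _ (R : pzRingType) (V : lmodType R) (v : V) :=
  GRing.isLinear.Build R R^o V *:%R (scale_by v)
    (fun a b c => etrans (scalerDl v (a * b) c)
      (congr1 (fun w => w + _) (esym (scalerA a b v)))).

Section PrimitivePowers.
Variables (K : fieldType) (A : algType K) (hA : hopf_algebra A) (a : A).
Hypothesis charK : [pchar K] =i pred0.
Hypothesis a_prim : primitive hA a.

Lemma comulX n : comul hA (a ^+ n) = (comul hA a) ^+ n.
Proof.
elim: n => [|n IHn]; first by rewrite !expr0 hopf_comul1.
by rewrite !exprS hopf_comulM IHn.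
Qed.

(** The binomial formula for the commuting elements a ⊗ 1 and 1 ⊗ a. *)
Lemma comul_dpow n : comul hA (dpow a n) = \sum_(i < n.+1) dpow a (n - i) ⊗ dpow a i.
Proof.
rewrite [dpow a n]dpow_def linearZ /= comulX a_prim -dpow_def dpowD //; last first.
  by rewrite /GRing.comm !tensM !mul1r !mulr1.
apply: eq_bigr => i _; rewrite !dpow_def tensXl tensXr -scalerAl -scalerAr tensM mul1r mulr1.
by rewrite tensZl tensZr.
Qed.

Lemma counit_dpow n : counit hA (dpow a n.+1) = 0.
Proof.
by rewrite !dpow_def linearZ exprS /= hopf_counitM (counit_primitive a_prim) mul0r scaler0.
Qed.

End PrimitivePowers.

Section WeakProjection.
Variables (K : fieldType) (E : algType K) (hE : hopf_algebra E) (x : E).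
Hypothesis charK : [pchar K] =i pred0.
Hypothesis x_prim : primitive hE x.
Variable D : {linear E -> E}.
Hypothesis D_mulx : forall c, D (x * c) = x * D c + c.
Hypothesis D_nil : forall c, exists n, iter n D c = 0.
Hypothesis D1 : D 1 = 0.
Hypothesis D_contl : forall n c, contl hE (counit hE \o iter n D) c = iter n D c.

Local Arguments polyalg_incl : simpl never.
Local Notation H := (polyalg x).
Local Notation X := (polyalg_gen x).
Local Notation incl := (@polyalg_incl K E x).

Lemma incl_dpow n : incl (dpow X n) = dpow x n.
Proof. by rewrite !dpow_def linearZ /= polyalg_inclX. Qed.

(** The antipode identity at the n-th divided power expresses its antipode through those of smaller
    powers. *)
Lemma antipode_polyalg h : exists h', antipode hE (incl h) = incl h'.
Proof.
elim/polyalg_ind: h => [|n].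
  split; first by exists 0; rewrite !linear0.
  by move=> a u v [u' uE] [v' vE]; exists (a *: u' + v'); rewrite !linearP /= uE vE.
rewrite dpowE //; suff [h' hE'] : exists h', antipode hE (incl (dpow X n)) = incl h'.
  by exists (n`!%:R *: h'); rewrite !linearZ /= hE'.
elim/ltn_ind: n => n IHn; have := antipodel hE (dpow x n).
have bil : bilinear_for *:%R *:%R (fun b c => antipode hE b * c).
  split=> [w|v] a u u' /=; first by rewrite linearP mulrDl scalerAl.
  by rewrite mulrDr scalerAr.
rewrite comul_dpow // tlift_sum // big_ord_recl /= subn0 dpow0 mulr1 => /(canRL (addrK _)).
rewrite -incl_dpow => ->.
have [k kE] : exists k : nat -> H, forall i : 'I_n,
    antipode hE (dpow x (n - i.+1)) = incl (k i).
  (* The value 0 for i >= n only makes the choice function total. *)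
  have H i : exists h', (i < n)%N -> antipode hE (dpow x (n - i.+1)) = incl h'.
    case: (ltnP i n) => [lt_in|_]; last by exists 0.
    have [|h' h'E] := IHn (n - i.+1)%N; first by rewrite ltn_subrL (leq_ltn_trans _ lt_in).
    by exists h'; rewrite -h'E incl_dpow.
  by have [k kP] := choice H; exists k => i; apply: kP.
exists ((counit hE (incl (dpow X n)) : K) *: (1 : H) -
  \sum_(i < n) k i * dpow X (lift ord0 i)).
rewrite linearB linearZ /= rmorph1 [incl (\sum_(_ < _) _)]linear_sum.
congr (_ - _); apply: eq_bigr => i _.
by rewrite rmorphM /= incl_dpow kE.
Qed.


Lemma weak_projection_exists :
  exists (hH : hopf_algebra H) (p : {linear E -> H}), weak_projection hH hE incl p.
Proof.
have [|p pP] := locally_finite_sum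
    (T := fun n => scale_by (dpow X n) \o counit hE \o iter n D).
  move=> c; have [n nc] := D_nil_leq D_nil c.
  by exists n => m nm /=; rewrite nc // !linear0.
have pE c n : (forall m, (n <= m)%N -> iter m D c = 0) ->
    p c = \sum_(m < n) counit hE (iter m D c) *: dpow X m.
  by move=> nc; apply: pP => m nm /=; rewrite nc // !linear0.
(* As eps(x) = 0, the zeroth term vanishes and eps(D^(m+1)(xc)) = (m+1) eps(D^m c); the factor m+1
   is absorbed by [dpowS]. *)
have p_mulx c : p (x * c) = X * p c.
  have [n nc] := D_nil_leq D_nil c.
  rewrite (pE c n nc) (pE (x * c) n.+1) => [|[//|m] nm]; last first.
    by rewrite iter_mulx // !nc ?mulr0 ?scaler0 ?addr0 // ltnW.
  rewrite big_ord_recl /= hopf_counitM (counit_primitive x_prim) mul0r scale0r add0r.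
  rewrite mulr_sumr; apply: eq_bigr => m _.
  rewrite -[D (iter _ D _)]/(iter m.+1 D _) iter_mulx // linearD linearZ /=.
  rewrite hopf_counitM (counit_primitive x_prim) mul0r add0r -scalerAr dpowS //.
  by rewrite scalerA mulrC.
have p_mul h : forall c, p (incl h * c) = h * p c.
  elim/polyalg_ind: h => [|n].
    split=> [d|a u v hu hv d]; first by rewrite linear0 !mul0r linear0.
    by rewrite linearP !mulrDl -!scalerAl linearP hu hv.
  rewrite polyalg_inclX; elim: n => [|n IHn] c; first by rewrite !expr0 !mul1r.
  by rewrite !exprS -!mulrA p_mulx IHn.
have p1 : p 1 = 1.
  rewrite (pE 1 1%N) => [|[//|m] _]; first by rewrite big_ord1 /= hopf_counit1 scale1r dpow0.
  by rewrite iterSr D1 linear0.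
have inclK : cancel incl p by move=> h; rewrite -[incl h]mulr1 p_mul p1 mulr1.
have incl_mul s t : tmap incl incl (s * t) = tmap incl incl s * tmap incl incl t.
  exact: tmap_mul.
have incl_inj : injective (tmap incl incl) := can_inj (tmap_cancel inclK inclK).
(* The coproduct of E maps K[x] into the image of K[x] ⊗ K[x], so composing with p ⊗ p merely
   restricts it. The antipode S is restricted through p in the same way. *)
pose d : {linear H -> (H ⊗ H)%type} := tmap p p \o comul hE \o incl.
have dE h : tmap incl incl (d h) = comul hE (incl h).
  suff [t tE] : exists t, comul hE (incl h) = tmap incl incl t.
    by rewrite /= tE (tmap_cancel inclK inclK).
  elim/polyalg_ind: h => [|n].
    split=> [|a u v [s sE] [t tE]]; first by exists 0; rewrite !linear0.
    by exists (a *: s + t); rewrite !linearP /= sE tE.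
  exists ((X ⊗ 1 + 1 ⊗ X) ^+ n); rewrite polyalg_inclX comulX x_prim.
  elim: n => [|n IHn]; first by rewrite !expr0 tmapE /= rmorph1.
  by rewrite !exprS incl_mul -IHn linearD /= !tmapE /= rmorph1.
have [hC [comulE counitE]] := retract_coalgebra (hC := hE) inclK dE.
have hC_comul : GRing.monoid_morphism (comul hC).
  split=> [|u v]; apply: incl_inj.
    by rewrite comulE dE rmorph1 hopf_comul1 tmapE /= rmorph1.
  by rewrite incl_mul !comulE !dE rmorphM hopf_comulM.
have hC_counit : GRing.monoid_morphism (counit hC).
  by split=> [|u v]; rewrite !counitE ?rmorph1 ?hopf_counit1 // rmorphM hopf_counitM.
pose S : {linear H -> H} := p \o antipode hE \o incl.
have SE h : incl (S h) = antipode hE (incl h).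
  by have [h' h'E] := antipode_polyalg h; rewrite /= h'E inclK.
have Sl a : tlift (fun b c => S b * c) (comul hC a) = (counit hC a : K) *: (1 : H).
  apply: (can_inj inclK).
  rewrite linearZ /= rmorph1 counitE -antipodel -dE -comulE; apply: tlift_tmap.
    split=> [w|v] k u u' /=; first by rewrite linearP mulrDl scalerAl.
    by rewrite mulrDr scalerAr.
  by move=> u v; transitivity (incl (S u) * incl v); [apply: rmorphM|rewrite SE].
have Sr a : tlift (fun b c => b * S c) (comul hC a) = (counit hC a : K) *: (1 : H).
  apply: (can_inj inclK).
  rewrite linearZ /= rmorph1 counitE -antipoder -dE -comulE; apply: tlift_tmap.
    split=> [w|v] k u u' /=; first by rewrite mulrDl scalerAl.
    by rewrite linearP mulrDr scalerAr.
  by move=> u v; transitivity (incl u * incl (S v)); [apply: rmorphM|rewrite SE].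
pose hH := HopfAlgebra hC_comul hC_counit Sl Sr.
have X_prim : primitive hH X.
  apply: incl_inj; rewrite [comul hH X]comulE dE [LHS]x_prim linearD /=.
  by rewrite !tmapE /= rmorph1.
exists hH, p; split=> //.
  split; first exact: can_inj inclK.
    by split=> h /=; rewrite ?comulE ?dE.
  by move=> h /=; rewrite SE.
split=> c.
  pose s := repr (comul hE c).
  have [N [Nc Ns]] : exists N, (forall m, (N <= m)%N -> iter m D c = 0) /\
      {in s, forall q m, (N <= m)%N -> iter m D q.1 = 0}.
    have [n nP] := choice (D_nil_leq D_nil).
    exists (maxn (n c) (\max_(q <- s) n q.1)); split=> [m|q qs m].
      by rewrite geq_max => /andP[/nP].
    rewrite geq_max => /andP[_ sm]; apply: nP; apply: leq_trans sm.
    exact: (@leq_bigmax_seq _ s xpredT (fun q : E * E => n q.1)).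
  (* Both sides equal this double sum: the coproduct of p c by grouping along antidiagonals, (p ⊗ p)
     of the coproduct of c because eps(D^i c_1) c_2 = D^i c. *)
  transitivity (\sum_(i < N) \sum_(j < N)
      counit hE (iter (i + j) D c) *: (dpow X i ⊗ dpow X j)).
    rewrite (@sum_triangle _ (fun i j =>
      counit hE (iter (i + j) D c) *: (dpow X i ⊗ dpow X j))).
      rewrite (pE c N Nc) linear_sum; apply: eq_bigr => m _.
      rewrite linearZ_LR (comul_dpow charK X_prim) scaler_sumr; apply: eq_bigr => i _.
      by rewrite subnK // -ltnS.
    by move=> i j /Nc ->; rewrite linear0 scale0r.
  transitivity (\sum_(q <- s) \sum_(i < N) (counit hE (iter i D q.1) *: dpow X i) ⊗ p q.2);
      last first.
    rewrite linear_tensor_sum [LHS]big_seq [RHS]big_seq; apply: eq_bigr => q qs.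
    by rewrite /= tmapE (pE q.1 N) ?tens_suml // => m; apply: Ns.
  rewrite [RHS]exchange_big; apply: eq_bigr => i _ /=.
  transitivity (dpow X i ⊗ p (iter i D c)).
    rewrite (pE _ N) => [|m Nm]; last by rewrite -iterD Nc // (leq_trans Nm) ?leq_addr.
    rewrite tens_sumr; apply: eq_bigr => j _.
    by rewrite tensZr -iterD addnC.
  rewrite -(D_contl i c) /contl /tlift linear_sum tens_sumr.
  by apply: eq_bigr => q _; rewrite linearZ tensZr tensZl.
(* For the counit only the zeroth term of p c contributes, and it gives eps(c). *)
have [n nc] := D_nil_leq D_nil c.
rewrite [LHS]counitE (pE c n.+1) => [|m /ltnW/nc//].
have vE m : counit hE (\val (dpow X m)) = counit hE (dpow x m) by rewrite -incl_dpow.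
rewrite !linear_sum big_ord_recl big1 => [|i _].
  by rewrite addr0 !linearZ vE dpow0 hopf_counit1; apply: mulr1.
by rewrite !linearZ vE (counit_dpow x_prim); apply: mulr0.
Qed.

End WeakProjection.

Theorem proposition9p18 (K : fieldType) (E : algType K) (hE : hopf_algebra E)
  (connE : connected hE) (charK : [pchar K] =i pred0)
  (E_neq_K : ~ forall y : E, exists a : K, y = a%:A)
  (x : E) (x_prim : primitive hE x) (x_neq0 : x <> 0) :
  (exists (hKx : hopf_algebra (polyalg x)) (p : {linear E -> polyalg x}),
     weak_projection hKx hE (polyalg_incl (x := x)) p) /\
  (exists f : {linear E -> (polyalg x ⊗ lmod_quot (right_ideal x))%type},
     bijective f).
Proof.
have [f f1 fx] := primitive_dual charK connE x_prim x_neq0.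
pose D : {linear E -> E} := contl hE f.
have D_mulx c : D (x * c) = x * D c + c := contl_primitive_dual x_prim fx c.
have D_nil c : exists n, iter n D c = 0 := contl_primitive_dual_nil connE f1 c.
split; last exact: weyl_splitting charK D_mulx D_nil.
apply: (weak_projection_exists charK x_prim D_mulx D_nil) => [|n c].
  exact: contl_primitive_dual1 f1.
exact: contl_counit_iter.
Qed.
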